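(* Let $0<e\le1$, let $\Phi=\widetilde\Phi$ be a nonnegative function on $[0,\infty)$, let $\widetilde B$ be an even nonnegative function on $[-1,1]$ and $B$ related to it by $B(s)=\frac{\widetilde B(\sqrt{(1-s)/2})}{2\sqrt{(1-s)/2}}$ (equivalently $\widetilde B(t)=2|t|B(1-2t^2)$). Let $K$ be a continuous real-valued function on $\Xi\times\Xi$, $\Xi=\mathbb{R}^3\times\mathbb{R}^3\times S^2$, such that the integrals below converge absolutely. Then, writing $u=v-w$, $k=u/|u|$, $$\frac1{4\pi}\iiint K[C_{s,e}^{-1}(v,w,\sigma),(v,w,\sigma)]\,\Phi_e^+(|u|,k\cdot\sigma)B_e^+(k\cdot\sigma)\,d\sigma\,dw\,dv=\frac1{4\pi}\iiint K[(v,w,\sigma),C_{s,e}(v,w,\sigma)]\,\Phi(|u|)B(k\cdot\sigma)\,d\sigma\,dw\,dv$$ and $$\frac1{4\pi}\iiint K[C_{r,e}^{-1}(v,w,n),(v,w,n)]\,\widetilde\Phi_e^+(|u|,k\cdot n)\widetilde B_e^+(k\cdot n)\,dn\,dw\,dv=\frac1{4\pi}\iiint K[(v,w,n),C_{r,e}(v,w,n)]\,\widetilde\Phi(|u|)\widetilde B(k\cdot n)\,dn\,dw\,dv,$$ all integrals being over $v,w\in\mathbb{R}^3$ and the sphere variable in $S^2$.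
   Context: $d\sigma$, $dn$: uniform measure on $S^2$ with total mass $4\pi$. Inelastic swapping map $C_{s,e}(v,w,\sigma)=(v',w',\sigma')$: $v'=\frac{v+w}2+\frac{1-e}4(v-w)+\frac{1+e}4|v-w|\sigma$, $w'=\frac{v+w}2-\frac{1-e}4(v-w)-\frac{1+e}4|v-w|\sigma$, $\sigma'=\frac{(1+e)k+(1-e)\sigma}{\sqrt{2(1+e^2)+2(1-e^2)k\cdot\sigma}}$; its inverse is $C_{s,e}^{-1}(v,w,\sigma)=(v^*,w^*,\sigma^* )$ with $v^*=\frac{v+w}2-\frac{1-e}{4e}(v-w)+\frac{1+e}{4e}|v-w|\sigma$, $w^*=\frac{v+w}2+\frac{1-e}{4e}(v-w)-\frac{1+e}{4e}|v-w|\sigma$, $\sigma^*=\frac{(1+e)k-(1-e)\sigma}{\sqrt{2(1+e^2)-2(1-e^2)k\cdot\sigma}}$. Inelastic reflection map $C_{r,e}(v,w,n)=(v-\frac{1+e}2(u\cdot n)n,\ w+\frac{1+e}2(u\cdot n)n,\ n)$, with inverse $C_{r,e}^{-1}(v,w,n)=(v-\frac{1+e}{2e}(u\cdot n)n,\ w+\frac{1+e}{2e}(u\cdot n)n,\ n)$. Modified kernels: $B_e^+(s)=B\Big(\frac{(1+e^2)s-(1-e^2)}{(1+e^2)-(1-e^2)s}\Big)\frac{\sqrt2}{\sqrt{(1+e^2)-(1-e^2)s}}\frac1e$, $\Phi_e^+(r,s)=\Phi\Big(\frac{r}{\sqrt2 e}\sqrt{(1+e^2)-(1-e^2)s}\Big)$,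 $\widetilde B_e^+(s)=\frac1e\widetilde B\Big(\frac{s}{\sqrt{e^2+(1-e^2)s^2}}\Big)$, $\widetilde\Phi_e^+(r,s)=\widetilde\Phi\Big(\frac re\sqrt{e^2+(1-e^2)s^2}\Big)$. *)

(* Defs.v *)
From HB Require Import structures.
From mathcomp Require Import all_boot all_order all_algebra.
From mathcomp Require Import all_classical all_reals all_analysis.
Set Implicit Arguments. Unset Strict Implicit. Unset Printing Implicit Defensive.
Import Order.TTheory GRing.Theory Num.Theory.
Import numFieldNormedType.Exports.
Local Open Scope classical_set_scope.
Local Open Scope ring_scope.

Notation vec R := ((R * R) * R)%type.

Section Vec.
Variable R : realType.
Definition vadd (x y : vec R) : vec R := ((x.1.1 + y.1.1, x.1.2 + y.1.2), x.2 + y.2).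
Definition vscale (a : R) (x : vec R) : vec R := ((a * x.1.1, a * x.1.2), a * x.2).
Definition vsub (x y : vec R) : vec R := vadd x (vscale (-1) y).
Definition vdot (x y : vec R) : R := x.1.1 * y.1.1 + x.1.2 * y.1.2 + x.2 * y.2.
Definition vnorm (x : vec R) : R := Num.sqrt (vdot x x).
(* x / |x| (equals 0 when x = 0, a null set everywhere below) *)
Definition vunit (x : vec R) : vec R := vscale (vnorm x)^-1 x.

Definition Xi := (vec R * vec R * vec R)%type.
Definition inXi (p : Xi) : Prop := vnorm p.2 = 1.

Definition leb3 := ((@lebesgue_measure R \x @lebesgue_measure R) \x @lebesgue_measure R)%E.

Definition leb9 := ((leb3 \x leb3) \x leb3)%E.

(* The uniform (surface) measure on S^2, total mass 4 pi, is realized as the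
   cone measure:  int_{S^2} f dsigma = 3 * int_{0 < |x| <= 1} f(x/|x|) dx.
   Hence for g : R^3 x R^3 x S^2 -> R,
   iiint g(v,w,sigma) dsigma dw dv
     = int_{ {(v,w,x) | 0 < |x| <= 1} } 3 * g(v, w, x/|x|) d(v,w,x). *)
Definition cone_dom : set Xi := [set p | 0 < vnorm p.2 <= 1].

Definition Xi_integrand (g : vec R -> vec R -> vec R -> R) (p : Xi) : \bar R :=
  (3 * g p.1.1 p.1.2 (vunit p.2))%:E.

Definition Xi_integral (g : vec R -> vec R -> vec R -> R) : \bar R :=
  (\int[leb9]_(p in cone_dom) Xi_integrand g p)%E.

Definition Xi_integrable (g : vec R -> vec R -> vec R -> R) : Prop :=
  leb9.-integrable cone_dom (Xi_integrand g).

Definition Cs (e : R) (v w s : vec R) : Xi :=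
  let u := vsub v w in let k := vunit u in
  let m := vscale (1/2) (vadd v w) in
  let a := vadd (vscale ((1 - e) / 4) u) (vscale ((1 + e) / 4 * vnorm u) s) in
  ((vadd m a, vsub m a),
   vscale (Num.sqrt (2 * (1 + e ^+ 2) + 2 * (1 - e ^+ 2) * vdot k s))^-1
          (vadd (vscale (1 + e) k) (vscale (1 - e) s))).

Definition Cs_inv (e : R) (v w s : vec R) : Xi :=
  let u := vsub v w in let k := vunit u in
  let m := vscale (1/2) (vadd v w) in
  let a := vadd (vscale (- ((1 - e) / (4 * e))) u) (vscale ((1 + e) / (4 * e) * vnorm u) s) in
  ((vadd m a, vsub m a),
   vscale (Num.sqrt (2 * (1 + e ^+ 2) - 2 * (1 - e ^+ 2) * vdot k s))^-1
          (vsub (vscale (1 + e) k) (vscale (1 - e) s))).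

Definition Cr (e : R) (v w n : vec R) : Xi :=
  let u := vsub v w in
  let d := vscale ((1 + e) / 2 * vdot u n) n in
  ((vsub v d, vadd w d), n).

Definition Cr_inv (e : R) (v w n : vec R) : Xi :=
  let u := vsub v w in
  let d := vscale ((1 + e) / (2 * e) * vdot u n) n in
  ((vsub v d, vadd w d), n).

Definition Bplus (B : R -> R) (e s : R) : R :=
  B (((1 + e ^+ 2) * s - (1 - e ^+ 2)) / ((1 + e ^+ 2) - (1 - e ^+ 2) * s))
  * (Num.sqrt 2 / Num.sqrt ((1 + e ^+ 2) - (1 - e ^+ 2) * s)) * e^-1.

Definition Phiplus (Phi : R -> R) (e r s : R) : R :=
  Phi (r / (Num.sqrt 2 * e) * Num.sqrt ((1 + e ^+ 2) - (1 - e ^+ 2) * s)).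

Definition Btplus (Bt : R -> R) (e s : R) : R :=
  e^-1 * Bt (s / Num.sqrt (e ^+ 2 + (1 - e ^+ 2) * s ^+ 2)).

Definition Phitplus (Phit : R -> R) (e r s : R) : R :=
  Phit (r / e * Num.sqrt (e ^+ 2 + (1 - e ^+ 2) * s ^+ 2)).

End Vec.

(* Main.v *)
(** For a fixed unit vector n, the reflection law (v, w) |-> (v', w') is a linear
map of R^6 of determinant -e, which gives the identity for the n-representation.

The sigma-representation reduces to it. Put S_n k = k - 2 (k . n) n. If
sigma = S_n k, the swapping map produces the same velocities (v', w') as the
reflection with normal n, and sigma' = S_n k'; moreover C_e^{-1} = C_{1/e} for
both maps. For fixed k the map n |-> S_n k is two-to-one from the sphere to
itself with Jacobian 4 |k . n|, so both sides of the sigma-identity become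
integrals over n with the weight 2 |k . n|.

The Jacobian of n |-> S_n k is found by moving k to the north pole with a
Householder reflection and comparing the gnomonic coordinates of n with the
stereographic coordinates of S_n k: both are given by the same point of R^2.
All changes of variables are composed of one-dimensional ones by Fubini. *)
Require Import Defs.
From HB Require Import structures.
From mathcomp Require Import all_boot all_order all_algebra.
From mathcomp Require Import all_classical all_reals all_analysis.
From mathcomp Require Import measurable_realfun ring lra.
Import Order.TTheory GRing.Theory Num.Theory.
Import numFieldNormedType.Exports.
Local Open Scope classical_set_scope.
Local Open Scope ring_scope.
Set Implicit Arguments. Unset Strict Implicit. Unset Printing Implicit Defensive.

(** [change_of_var m1 m2 T J] pulls integrals of nonnegative extended-valued functions back along
    [T].

    Degenerate parameters are discarded as null sets: equal velocities, and normals with vanishing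
    third coordinate, by which the shears divide. Since [K] has no sign, each integral is split into
    its positive and negative parts and the identities are proved for each part.

    Velocities are always substituted at fixed n, by the inverse law with coefficient (1 + 1/e)/2.
    It multiplies u . n by -1/e, whence the factor 1/e of the modified kernels; their remaining
    factors record how |u|, k . n and the weight 2 |k . n| change under it. *)

Definition change_of_var {d1 d2} {X : measurableType d1} {Y : measurableType d2}
    {R : realType} (m1 : set X -> \bar R) (m2 : set Y -> \bar R)
    (T : X -> Y) (J : X -> R) :=
  [/\ measurable_fun [set: X] T, measurable_fun [set: X] J, forall x, 0 <= J x &
   forall F : Y -> \bar R, measurable_fun [set: Y] F -> (forall y, 0 <= F y)%E ->
     (\int[m2]_y F y = \int[m1]_x (F (T x) * (J x)%:E))%E].

(** * Measures with a density and general rules for changes of variables *)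

Definition density {d} {X : measurableType d} {R : realType}
    (m : set X -> \bar R) (J : X -> R) (A : set X) : \bar R :=
  (\int[m]_(x in A) (J x)%:E)%E.

Section density.
Local Open Scope ereal_scope.
Context d (X : measurableType d) (R : realType).
Variables (m : {measure set X -> \bar R}) (J : X -> R).
Hypothesis mJ : measurable_fun setT J.
Hypothesis J0 : forall x, (0 <= J x)%R.

Let mJe (A : set X) : measurable_fun A (fun x => (J x)%:E).
Proof. by apply/measurable_EFinP; exact: measurable_funTS. Qed.

Let nu := density m J.

Let nu0 : nu set0 = 0. Proof. exact: integral_set0. Qed.

Let nu_ge0 A : 0 <= nu A.
Proof. by apply: integral_ge0 => x _; rewrite lee_fin. Qed.

Let nu_sigma_additive : semi_sigma_additive nu.
Proof.
move=> F mF tF mUF.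
rewrite [X in _ --> X](_ : _ = \sum_(0 <= i <oo) nu (F i)).
  by apply: is_cvg_ereal_nneg_natsum_cond => n _ _; exact: nu_ge0.
by apply: ge0_integral_bigcup => // x _; rewrite lee_fin.
Qed.

HB.instance Definition _ :=
  isMeasure.Build _ _ _ nu nu0 nu_ge0 nu_sigma_additive.

Definition density_measure : {measure set X -> \bar R} := nu.

Import HBNNSimple.

(** For an indicator function this is the definition of [density]. Linearity extends it to simple
    functions, and monotone convergence on both sides to [F]. *)
Lemma ge0_integral_density (F : X -> \bar R) :
  measurable_fun setT F -> (forall x, 0 <= F x) ->
  \int[nu]_x F x = \int[m]_x (F x * (J x)%:E).
Proof.
move=> mF F0; pose f_ := nnsfun_approx measurableT mF.
have cvf x : (f_ n x)%:E @[n --> \oo] --> F x.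
  by apply: cvg_nnsfun_approx => //.
have ndf x : {homo (fun n => f_ n x) : a b / (a <= b)%N >-> (a <= b)%R}.
  by move=> a b ab; exact/lefP/nd_nnsfun_approx.
transitivity (limn (fun n => \int[nu]_x (f_ n x)%:E)).
  rewrite -monotone_convergence//.
  - by apply: eq_integral => x _; apply/esym/cvg_lim.
  - by move=> n; exact/measurable_EFinP/measurable_funP.
  - by move=> n x _; rewrite lee_fin.
  - by move=> x _ a b ab; rewrite lee_fin; exact: ndf.
transitivity (limn (fun n => \int[m]_x ((f_ n x)%:E * (J x)%:E))); last first.
  rewrite -monotone_convergence//.
  - apply: eq_integral => x _; apply/cvg_lim => //.
    by apply: cvgeZr => //; exact: cvf.
  - move=> n; apply: emeasurable_funM => //.
    exact/measurable_EFinP/measurable_funP.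
  - by move=> n x _; rewrite mule_ge0// lee_fin.
  - by move=> x _ a b ab; rewrite lee_wpmul2r// lee_fin//; exact: ndf.
congr (limn _); apply/funext => n.
transitivity (\sum_(k \in range (f_ n)) k%:E * nu (f_ n @^-1` [set k])).
  by rewrite integralT_nnsfun sintegralE.
transitivity (\int[m]_x \sum_(k \in range (f_ n))
   (k%:E * ((\1_(f_ n @^-1` [set k]) x)%:E * (J x)%:E))); last first.
  apply: eq_integral => x _.
  rewrite [in RHS](fimfunE (f_ n) x) -fsumEFin// ge0_mule_fsuml//.
    by apply: eq_fsbigr => k _; rewrite EFinM muleA.
  by move=> k; exact: nnfun_muleindic_ge0.
rewrite ge0_integral_fsum//; last 2 first.
- move=> k; apply/emeasurable_funM => //; apply: emeasurable_funM => //.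
  exact/measurable_EFinP.
- move=> k x _; rewrite muleA mule_ge0 ?lee_fin//.
  exact: nnfun_muleindic_ge0.
apply: eq_fsbigr => k /[1!inE] -[x _ <-].
rewrite ge0_integralZl//.
- congr (_ * _); rewrite /nu /density [LHS]integral_mkcond.
  apply: eq_integral => y _; rewrite patchE indicE/=.
  by case: ifPn; rewrite ?mul1e ?mul0e.
- apply: emeasurable_funM => //; exact/measurable_EFinP.
- by move=> y _; rewrite mule_ge0 ?lee_fin.
- by rewrite lee_fin.
Qed.

End density.

(** Written as y (y^2)^(-1), the inverse becomes a product with a real power, which is measurable on
    the whole line; at y = 0 both expressions are 0 by convention. *)
Lemma measurable_funV d (T : measurableType d) (R : realType) (f : T -> R) :
  measurable_fun [set: T] f -> measurable_fun [set: T] (fun x => (f x)^-1).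
Proof.
move=> mf; rewrite (_ : (fun _ => _) = (fun x => f x * (f x ^+ 2) `^ (-1))).
  apply: measurable_funM => //.
  apply: (measurableT_comp (f := fun y : R => y `^ (-1))).
    exact: measurable_powR.
  exact: measurable_funX.
apply/funext => x; rewrite powR_inv1 ?sqr_ge0//.
by have [->|fx0] := eqVneq (f x) 0; [rewrite mul0r invr0|field].
Qed.

Lemma measurable_fun_sqrt d (T : measurableType d) (R : realType) (f : T -> R) :
  measurable_fun [set: T] f -> measurable_fun [set: T] (fun x => Num.sqrt (f x)).
Proof.
move=> mf; apply: (measurableT_comp _ mf).
apply: continuous_measurable_fun; exact: sqrt_continuous.
Qed.

Section change_of_var.
Local Open Scope ereal_scope.
Context {R : realType}.

(** The hypothesis on sets says that [m2] is the image under [T] of the measure with density [J], so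
    the claim is integration against a pushforward. *)
Lemma change_of_var_sets d1 d2 (X : measurableType d1) (Y : measurableType d2)
    (m1 : {measure set X -> \bar R}) (m2 : {measure set Y -> \bar R})
    (T : X -> Y) (J : X -> R) :
  measurable_fun [set: X] T -> measurable_fun [set: X] J ->
  (forall x, 0 <= J x)%R ->
  (forall A, measurable A -> m2 A = density m1 J (T @^-1` A)) ->
  change_of_var m1 m2 T J.
Proof.
move=> mT mJ J0 m2E; split=> // F mF F0.
have mFT : measurable_fun [set: X] (F \o T) by exact: measurableT_comp.
rewrite -[RHS](ge0_integral_density m1 mJ J0 mFT)//; last by move=> x; exact: F0.
pose nuM := density_measure m1 mJ J0.
transitivity (\int[nuM]_x (F (T x))) => //.
rewrite -(setTI [set: X]) -[X in X `&` _](preimage_setT T) setIT.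
rewrite -(ge0_integral_pushforward mT nuM)//.
by apply: eq_measure_integral => A mA _; exact: m2E.
Qed.

Lemma change_of_var_comp d1 d2 d3 (X : measurableType d1)
    (Y : measurableType d2) (Z : measurableType d3)
    (m1 : {measure set X -> \bar R}) (m2 : set Y -> \bar R) (m3 : set Z -> \bar R)
    (T : X -> Y) (J : X -> R) (S : Y -> Z) (I : Y -> R) :
  change_of_var m1 m2 T J -> change_of_var m2 m3 S I ->
  change_of_var m1 m3 (S \o T) (fun x => I (T x) * J x)%R.
Proof.
move=> [mT mJ J0 TE] [mS mI I0 SE]; split.
- exact: measurableT_comp.
- by apply: measurable_funM => //; exact: measurableT_comp.
- by move=> x; rewrite mulr_ge0.
- move=> F mF F0; rewrite SE// TE//.
  + by apply: eq_integral => x _; rewrite -muleA -EFinM.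
  + apply: emeasurable_funM; first exact: measurableT_comp.
    exact/measurable_EFinP.
  + by move=> y; rewrite mule_ge0 ?lee_fin.
Qed.

Section product.
Context d0 d1 d2 (A : measurableType d0)
  (X : measurableType d1) (Y : measurableType d2).
Variables (m0 : {sigma_finite_measure set A -> \bar R})
  (m1 : {sigma_finite_measure set X -> \bar R})
  (m2 : {sigma_finite_measure set Y -> \bar R}).

(** The first component is fixed, so Tonelli reduces the claim to slices. Requiring it for almost
    every slice only is what lets degenerate parameters be dropped later. *)
Lemma change_of_var_snd (T : A * X -> Y) (J : A * X -> R) :
  measurable_fun [set: A * X] T -> measurable_fun [set: A * X] J ->
  (forall p, 0 <= J p)%R ->
  {ae m0, forall a,
    change_of_var m1 m2 (fun x => T (a, x)) (fun x => J (a, x))} ->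
  change_of_var (m0 \x m1) (m0 \x m2) (fun p => (p.1, T p)) J.
Proof.
move=> mT mJ J0 aT; split => //; first exact: measurable_fun_pair.
move=> F mF F0.
have mG : measurable_fun [set: A * X] (fun p => F (p.1, T p) * (J p)%:E).
  apply: emeasurable_funM; last exact/measurable_EFinP.
  by apply: measurableT_comp => //; exact: measurable_fun_pair.
have G0 p : 0 <= F (p.1, T p) * (J p)%:E by rewrite mule_ge0 ?lee_fin.
rewrite fubini_tonelli1// fubini_tonelli1//.
apply: ge0_ae_eq_integral => //.
- exact: measurable_fun_fubini_tonelli_F.
- exact: measurable_fun_fubini_tonelli_F.
- by move=> a _; apply: integral_ge0.
- by move=> a _; apply: integral_ge0.
apply: filterS aT => a [_ _ _ TE] _; rewrite /fubini_F/= TE//.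
exact: measurable_fun_pair2.
Qed.

Lemma change_of_var_fst (T : X * A -> Y) (J : X * A -> R) :
  measurable_fun [set: X * A] T -> measurable_fun [set: X * A] J ->
  (forall p, 0 <= J p)%R ->
  {ae m0, forall a,
    change_of_var m1 m2 (fun x => T (x, a)) (fun x => J (x, a))} ->
  change_of_var (m1 \x m0) (m2 \x m0) (fun p => (T p, p.2)) J.
Proof.
move=> mT mJ J0 aT; split => //; first exact: measurable_fun_pair.
move=> F mF F0.
have mG : measurable_fun [set: X * A] (fun p => F (T p, p.2) * (J p)%:E).
  apply: emeasurable_funM; last exact/measurable_EFinP.
  by apply: measurableT_comp => //; exact: measurable_fun_pair.
have G0 p : 0 <= F (T p, p.2) * (J p)%:E by rewrite mule_ge0 ?lee_fin.
rewrite fubini_tonelli2// fubini_tonelli2//.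
apply: ge0_ae_eq_integral => //.
- exact: measurable_fun_fubini_tonelli_G.
- exact: measurable_fun_fubini_tonelli_G.
- by move=> a _; apply: integral_ge0.
- by move=> a _; apply: integral_ge0.
apply: filterS aT => a [_ _ _ TE] _; rewrite /fubini_G/= TE//.
exact: measurable_fun_pair1.
Qed.

End product.
End change_of_var.

(** * Change of variables on the line *)

Section lebesgue1.
Context {R : realType}.
Local Notation lam := (@lebesgue_measure R).

Lemma integral_derive (f F : R -> R) (a b : R) : a < b ->
  (forall x, a <= x <= b -> is_derive x 1 F (f x)) ->
  (forall x, a <= x <= b -> {for x, continuous f}) ->
  (\int[lam]_(x in `[a, b]) (f x)%:E = (F b - F a)%:E)%E.
Proof.
move=> ab dF cf.
have cF x : a <= x <= b -> {for x, continuous F}.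
  move=> /dF[dFx _]; apply: differentiable_continuous.
  exact/derivable1_diffP.
have [aab abb] : a <= a <= b /\ a <= b <= b by rewrite !lexx (ltW ab).
rewrite (@continuous_FTC2 _ _ F) ?EFinB//.
- apply: continuous_in_subspaceT => x /[!inE]/= /[!in_itv]/= xab; exact: cf.
- split.
  + move=> x /[!in_itv]/= /andP[ax xb].
    by have [] : is_derive x 1 F (f x) by apply: dF; rewrite !ltW.
  + exact: (cvg_at_right_filter (cF _ aab)).
  + exact: (cvg_at_left_filter (cF _ abb)).
- move=> x /[!in_itv]/= /andP[ax xb].
  have dFx : is_derive x 1 F (f x) by apply: dF; rewrite !ltW.
  by rewrite derive1E derive_val.
Qed.

(** Lebesgue measure is determined by its values on the intervals ]a, b], so only their preimages
    have to be measured. *)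
Lemma change_of_var_lebesgue d (X : measurableType d)
    (m : {measure set X -> \bar R}) (T : X -> measurableTypeR R) (J : X -> R) :
  measurable_fun [set: X] T -> measurable_fun [set: X] J ->
  (forall x, 0 <= J x) ->
  (forall a b, a <= b ->
    density m J (T @^-1` `]a, b]%classic) = (b - a)%:E) ->
  change_of_var m lam T J.
Proof.
move=> mT mJ J0 mE; apply: change_of_var_sets => // A mA.
pose nu : {measure set (measurableTypeR R) -> \bar R} :=
  pushforward (density_measure m mJ J0) T.
apply: (@lebesgue_measure_unique _ (nu mT)) => // _ [[a b] _ <-]/=.
rewrite /pushforward lebesgue_measure_itv/= lte_fin.
have [ab|ba] := ltP a b; first by rewrite -EFinB -(mE _ _ (ltW ab)).
rewrite (_ : _ @^-1` _ = set0) ?measure0//.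
by rewrite set_itv_ge// -leNgt bnd_simp.
Qed.

Lemma change_of_var_affine (a b : R) : a != 0 ->
  change_of_var lam lam (fun x => a * x + b) (fun=> `|a|).
Proof.
move=> a0; apply: change_of_var_lebesgue => //.
  by apply: measurable_funD => //; apply: measurable_funM.
move=> c d cd; rewrite /density.
rewrite integral_cst//; last first.
  rewrite -[X in measurable X]setTI.
  have : measurable_fun [set: R] (fun x : R => a * x + b).
    by apply: measurable_funD => //; apply: measurable_funM.
  by apply => //; exact: measurable_itv.
have [an|ap|az] := ltgtP a 0; last by rewrite az eqxx in a0.
- rewrite (_ : _ @^-1` _ = `[(d - b) / a, (c - b) / a[%classic).
    rewrite /= lebesgue_measure_itv/= lte_fin ltr0_norm//.
    case: ltP => [_|]; first by rewrite -EFinB -EFinM; congr EFin; field.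
    rewrite ler_ndivrMr// divrK ?unitfE//; rewrite lerD2r mule0 => dc.
    by rewrite (@le_anti _ _ c d) ?subrr// cd.
  apply/seteqP; split=> x/=; rewrite !in_itv/= => /andP[h1 h2].
    by rewrite ler_ndivrMr// ltr_ndivlMr//; apply/andP; split; lra.
  move: h1 h2; rewrite ler_ndivrMr// ltr_ndivlMr// => h1 h2.
  by apply/andP; split; lra.
- rewrite (_ : _ @^-1` _ = `](c - b) / a, (d - b) / a]%classic).
    rewrite /= lebesgue_measure_itv/= lte_fin gtr0_norm//.
    case: ltP => [_|]; first by rewrite -EFinB -EFinM; congr EFin; field.
    rewrite ler_pdivrMr// divrK ?unitfE//; rewrite lerD2r mule0 => dc.
    by rewrite (@le_anti _ _ c d) ?subrr// cd.
  apply/seteqP; split=> x/=; rewrite !in_itv/= => /andP[h1 h2].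
    by rewrite ler_pdivlMr// ltr_pdivrMr//; apply/andP; split; lra.
  move: h1 h2; rewrite ler_pdivlMr// ltr_pdivrMr// => h1 h2.
  by apply/andP; split; lra.
Qed.

End lebesgue1.

(** * Automated measurability of real and vector expressions *)

Lemma measurable_fun_fst d d1 d2 (T : measurableType d) (A : measurableType d1)
    (B : measurableType d2) (f : T -> A * B) :
  measurable_fun [set: T] f -> measurable_fun [set: T] (fun x => (f x).1).
Proof. exact: measurableT_comp. Qed.

Lemma measurable_fun_snd d d1 d2 (T : measurableType d) (A : measurableType d1)
    (B : measurableType d2) (f : T -> A * B) :
  measurable_fun [set: T] f -> measurable_fun [set: T] (fun x => (f x).2).
Proof. exact: measurableT_comp. Qed.

(** Syntax-directed, with the subterms passed explicitly so that no higher-order unification is left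
    to guess. The last two cases fail on an unmatched abstraction and eta-expand anything else,
    which excludes a loop. *)
Ltac measurable_step := lazymatch goal with
  | H : measurable_fun _ ?f |- measurable_fun _ (fun x => ?f x) => exact: H
  | |- measurable_fun _ (fun x => x) => exact: measurable_id
  | |- measurable_fun _ (fun _ => ?c) => exact: measurable_cst
  | |- measurable_fun _ (fun x => fst (@?f x)) =>
      apply: (measurable_fun_fst (f := f))
  | |- measurable_fun _ (fun x => snd (@?f x)) =>
      apply: (measurable_fun_snd (f := f))
  | |- measurable_fun _ (fun x => (@?f x, @?g x)) =>
      apply: (measurable_fun_pair (f := f) (g := g))
  | |- measurable_fun _ (fun x => (@?f x + @?g x)%R) =>
      apply: (measurable_funD (f := f) (g := g))
  | |- measurable_fun _ (fun x => (@?f x * @?g x)%R) =>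
      apply: (measurable_funM (f := f) (g := g))
  | |- measurable_fun _ (fun x => (- @?f x)%R) =>
      apply: (measurable_funN (f := f))
  | |- measurable_fun _ (fun x => ((@?f x)^-1)%R) =>
      apply: (measurable_funV (f := f))
  | |- measurable_fun _ (fun x => (@?f x ^+ _)%R) =>
      apply: (measurable_funX (f := f))
  | |- measurable_fun _ (fun x => Num.sqrt (@?f x)) =>
      apply: (measurable_fun_sqrt (f := f))
  | |- measurable_fun _ (fun x => `|@?f x|%R) =>
      apply: (measurableT_comp (@normr_measurable _ setT) (g := f))
  | |- measurable_fun _ (fun x => (@?f x < @?g x)%R) =>
      apply: (measurable_fun_ltr (f := f) (g := g))
  | |- measurable_fun _ (fun x => (@?f x <= @?g x)%R) =>
      apply: (measurable_fun_ler (f := f) (g := g))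
  | |- measurable_fun _ (fun x => @?f x && @?g x) =>
      apply: (measurable_and (f := f) (g := g))
  | |- measurable_fun _ (fun x => if _ then _ else _) =>
      apply: measurable_fun_ifT
  | |- measurable_fun _ (fun _ => _) => fail
  | |- @measurable_fun _ _ ?T ?U ?D ?h =>
      change (@measurable_fun _ _ T U D (fun x => h x))
  end.
Ltac measurable_tac := repeat (cbv beta; measurable_step).

Section measurable_vec.
Context {R : realType} d (T : measurableType d).
Local Notation M := (measurableTypeR R).
Local Notation V := (M * M * M)%type.
Variables (f g : T -> V) (a : T -> R).
Hypothesis mf : measurable_fun [set: T] f.
Hypothesis mg : measurable_fun [set: T] g.
Hypothesis ma : measurable_fun [set: T] a.

Lemma measurable_vadd : measurable_fun [set: T] (fun x => vadd (f x) (g x) : V).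
Proof. rewrite /vadd; measurable_tac. Qed.

Lemma measurable_vscale :
  measurable_fun [set: T] (fun x => vscale (a x) (f x) : V).
Proof. rewrite /vscale; measurable_tac. Qed.

Lemma measurable_vdot : measurable_fun [set: T] (fun x => vdot (f x) (g x)).
Proof. rewrite /vdot; measurable_tac. Qed.

End measurable_vec.

Section measurable_vec2.
Context {R : realType} d (T : measurableType d).
Local Notation M := (measurableTypeR R).
Local Notation V := (M * M * M)%type.
Variables (f g : T -> V).
Hypothesis mf : measurable_fun [set: T] f.
Hypothesis mg : measurable_fun [set: T] g.

Lemma measurable_vsub : measurable_fun [set: T] (fun x => vsub (f x) (g x) : V).
Proof.
by apply: measurable_vadd => //; apply: measurable_vscale => //; exact: measurable_cst.
Qed.

Lemma measurable_vnorm : measurable_fun [set: T] (fun x => vnorm (f x)).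
Proof. by apply: measurable_fun_sqrt; exact: measurable_vdot. Qed.

Lemma measurable_vunit : measurable_fun [set: T] (fun x => vunit (f x) : V).
Proof.
apply: measurable_vscale => //; apply: measurable_funV; apply: measurable_fun_sqrt.
exact: measurable_vdot.
Qed.

End measurable_vec2.

Ltac measurable_vec := repeat (cbv beta; lazymatch goal with
  | |- measurable_fun _ (fun x => vadd (@?f x) (@?g x)) =>
      apply: (measurable_vadd (f := f) (g := g))
  | |- measurable_fun _ (fun x => vsub (@?f x) (@?g x)) =>
      apply: (measurable_vsub (f := f) (g := g))
  | |- measurable_fun _ (fun x => vscale (@?a x) (@?f x)) =>
      apply: (measurable_vscale (a := a) (f := f))
  | |- measurable_fun _ (fun x => vdot (@?f x) (@?g x)) =>
      apply: (measurable_vdot (f := f) (g := g))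
  | |- measurable_fun _ (fun x => vnorm (@?f x)) =>
      apply: (measurable_vnorm (f := f))
  | |- measurable_fun _ (fun x => vunit (@?f x)) =>
      apply: (measurable_vunit (f := f))
  | |- _ => measurable_step
  end).

(** * One-dimensional computations for the radial and vertical coordinates *)

Section lebesgue1_integrals.
Context {R : realType}.
Local Notation lam := (@lebesgue_measure R).

Lemma integral_sqr (a b : R) : a < b ->
  (\int[lam]_t (if a <= t <= b then t ^+ 2 else 0)%:E =
   ((b ^+ 3 - a ^+ 3) / 3)%:E)%E.
Proof.
move=> ab; pose f (t : R) := t ^+ 2; pose F (t : R) := 3^-1 * t ^+ 3.
have dF x : a <= x <= b -> is_derive x 1 F (f x).
  by move=> _; apply: is_derive_eq; rewrite /GRing.scale/= /f; field.
have cf x : a <= x <= b -> {for x, continuous f}.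
  move=> _; apply: differentiable_continuous; exact/derivable1_diffP.
transitivity (\int[lam]_(t in `[a, b]) (f t)%:E)%E.
  rewrite [RHS]integral_mkcond; apply: eq_integral => t _.
  rewrite patchE (_ : (t \in _) = (a <= t <= b)).
    by case: ifP.
  by apply/idP/idP; rewrite inE/= in_itv.
by rewrite (integral_derive ab dF cf) /F; congr EFin; field.
Qed.

(* With [c = y1^2 + y2^2], the substitution [y3 = c / (4 t) - t] amounts to
   [2 t = |y| - y3]. *)
Lemma change_of_var_height (c : R) : 0 < c ->
  change_of_var lam lam (fun t => c / (4 * t) - t)
    (fun t => if 0 < t then c / (4 * t ^+ 2) + 1 else 0).
Proof.
move=> c0; pose T (t : R) := c / (4 * t) - t.
pose J (t : R) := c / (4 * t ^+ 2) + 1.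
(* The positive root t of 4 t^2 + 4 y t = c, that is, the inverse of [T] on positive t. *)
pose S (y : R) := (Num.sqrt (y ^+ 2 + c) - y) / 2.
have sq y : Num.sqrt (y ^+ 2 + c) ^+ 2 = y ^+ 2 + c.
  by rewrite sqr_sqrtr// addr_ge0 ?sqr_ge0// ltW.
have sq_gt y : `|y| < Num.sqrt (y ^+ 2 + c).
  by rewrite -sqrtr_sqr ltr_sqrt ?ltrDl//; have := sqr_ge0 y; lra.
have S0 y : 0 < S y.
  rewrite /S divr_gt0// subr_gt0 (le_lt_trans _ (sq_gt y))//; exact: ler_norm.
(* [T] decreases on positive t: the preimage of ]a, b] there is [S b, S a[, and the antiderivative
   of [J] is [- T]. *)
have leT (t y : R) : 0 < t -> (T t <= y) = (S y <= t).
  move=> t0; have t40 : 0 < 4 * t by lra.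
  rewrite /T lerBlDr ler_pdivrMr// /S ler_pdivrMr//.
  have h := sq y; have h1 := sq_gt y; have h2 := ler_norm (- y).
  rewrite normrN in h2; set s := Num.sqrt _ in h h1 *.
  by apply/idP/idP => h3; nra.
have TS y : T (S y) = y.
  have := S0 y; rewrite /T /S => h0.
  have h := sq y; set s := Num.sqrt _ in h h0 *.
  have {h} -> : c = s ^+ 2 - y ^+ 2 by rewrite h; ring.
  by field; lra.
have dV (t : R) : 0 < t -> is_derive t 1 (fun y : R => y^-1) (- t ^- 2).
  move=> t0; have tn0 : (id t : R) != 0 by rewrite gt_eqF.
  apply: is_derive_eq (is_deriveV tn0 (is_derive_id t (1 : R))) _.
  by rewrite /GRing.scale/= mulr1.
have dT (t : R) : 0 < t -> is_derive t 1 (fun t => - T t) (J t).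
  move=> t0; rewrite (_ : (fun _ => _) =
      (id : R -> R) - (c / 4) \*: (fun y : R => y^-1)); last first.
    by apply/funext => y; rewrite /T !fctE/= /GRing.scale/= invfM; ring.
  apply: is_derive_eq (is_deriveB (is_derive_id t (1 : R))
    (is_deriveZ (c / 4) (dV _ t0))) _.
  by rewrite /J /GRing.scale/=; field; rewrite gt_eqF.
have cJ (t : R) : 0 < t -> {for t, continuous J}.
  move=> t0; rewrite (_ : J =
      (c / 4) \*: ((fun y : R => y^-1) ^+ 2) + cst (1 : R)); last first.
    by apply/funext => y; rewrite /J !fctE/= /GRing.scale/= invfM exprVn; ring.
  apply: differentiable_continuous; apply/derivable1_diffP.
  have [dVt _] := dV _ t0.
  apply: derivableD; last exact: derivable_cst.
  by apply: derivableZ; exact: derivableX.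
apply: change_of_var_lebesgue.
- measurable_tac.
- measurable_tac.
- move=> t; case: ifPn => // t0; rewrite addr_ge0// divr_ge0 ?ltW//.
  by rewrite pmulr_rgt0// exprn_gt0.
move=> a b; rewrite le_eqVlt => /predU1P[->|ab].
  by rewrite /density set_itv_ge ?bnd_simp ?ltxx// preimage_set0 integral_set0 subrr.
have Sba : S b < S a.
  rewrite ltNge; apply/negP; rewrite -leT// TS; lra.
rewrite /density integral_mkcond.
transitivity (\int[lam]_(t in `[S b, (S a)]) (J t)%:E)%E; last first.
  have dT' x : S b <= x <= S a -> is_derive x 1 (fun t => - T t) (J x).
    by move=> /andP[Sx _]; apply: dT; exact: lt_le_trans Sx.
  have cJ' x : S b <= x <= S a -> {for x, continuous J}.
    by move=> /andP[Sx _]; apply: cJ; exact: lt_le_trans Sx.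
  by rewrite (integral_derive Sba dT' cJ') !TS; congr EFin; ring.
rewrite -integral_itv_bndo_bndc; last first.
  apply/measurable_EFinP/measurable_funTS; rewrite /J; measurable_tac.
rewrite [RHS]integral_mkcond; apply: eq_integral => t _; rewrite !patchE.
have [t0|t0] := ltP 0 t.
  rewrite (_ : (t \in _ @^-1` _) = (t \in `[S b, S a[%classic))//.
  have Tab : (a < T t <= b) = (S b <= t < S a).
    by rewrite leT// ltNge leT// -ltNge andbC.
  by apply/idP/idP; rewrite !inE/= !in_itv/= Tab.
rewrite if_same; case: ifPn => //; rewrite inE/= in_itv/= => /andP[h1 _].
by move: (lt_le_trans (S0 b) h1); rewrite ltNge t0.
Qed.
End lebesgue1_integrals.

(** * Products of changes of variables, and null sets of product measures *)

Section change_of_var_extra.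
Local Open Scope ereal_scope.
Context {R : realType}.

Lemma change_of_var_eq d1 d2 (X : measurableType d1) (Y : measurableType d2)
    (m1 : set X -> \bar R) (m2 : set Y -> \bar R)
    (T T' : X -> Y) (J J' : X -> R) :
  change_of_var m1 m2 T J -> T =1 T' -> J =1 J' -> change_of_var m1 m2 T' J'.
Proof. by move=> + /funext <- /funext <-. Qed.

Lemma change_of_var_pair d1 d2 d1' d2' (X : measurableType d1)
    (Y : measurableType d2) (X' : measurableType d1') (Y' : measurableType d2')
    (m1 : {sigma_finite_measure set X -> \bar R})
    (m2 : {sigma_finite_measure set Y -> \bar R})
    (m1' : {sigma_finite_measure set X' -> \bar R})
    (m2' : {sigma_finite_measure set Y' -> \bar R})
    (T : X -> X') (J : X -> R) (S : Y -> Y') (I : Y -> R) :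
  change_of_var m1 m1' T J -> change_of_var m2 m2' S I ->
  change_of_var (m1 \x m2) (m1' \x m2')
    (fun p => (T p.1, S p.2)) (fun p => I p.2 * J p.1)%R.
Proof.
move=> TJ SI; have [mT mJ J0 _] := TJ; have [mS mI I0 _] := SI.
have fT : change_of_var (m1 \x m2) (m1' \x m2)
    (fun p => (T p.1, p.2)) (J \o fst).
  apply: change_of_var_fst => //=; try exact: measurableT_comp.
  by apply: aeW => y.
have fS : change_of_var (m1' \x m2) (m1' \x m2')
    (fun p => (p.1, S p.2)) (I \o snd).
  apply: change_of_var_snd => //=; try exact: measurableT_comp.
  by apply: aeW => y.
exact: (change_of_var_comp fT fS).
Qed.

Lemma ae_imp d (X : measurableType d)
    (m : {sigma_finite_measure set X -> \bar R}) (P Q : X -> Prop) :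
  {ae m, forall x, P x} -> (forall x, P x -> Q x) -> {ae m, forall x, Q x}.
Proof. by move=> aP PQ; apply: filterS aP. Qed.

(** A measurable set whose sections are all null is null. [P] is boolean so that its exceptional set
    is the preimage of a point, hence measurable. *)
Lemma ae_prod_snd d1 d2 (X : measurableType d1) (Y : measurableType d2)
    (m1 : {sigma_finite_measure set X -> \bar R})
    (m2 : {sigma_finite_measure set Y -> \bar R}) (P : X * Y -> bool) :
  measurable_fun [set: X * Y] P ->
  (forall x, {ae m2, forall y, P (x, y)}) -> {ae m1 \x m2, forall p, P p}.
Proof.
move=> mP aeP; exists (P @^-1` [set false]).
split; last by move=> p /= /negP/negbTE.
- by rewrite -[X in measurable X]setTI; exact: mP.
rewrite /product_measure1 integral0_eq// => x _ /=.
rewrite (_ : xsection _ _ = [set y | ~ P (x, y)]).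
  have [N [mN N0 PN]] := aeP x.
  apply/eqP; rewrite eq_le measure_ge0 andbT -N0.
  apply: le_measure => //; rewrite inE//.
  rewrite (_ : [set _ | _] = xsection (P @^-1` [set false]) x).
    apply: measurable_xsection.
    by rewrite -[X in measurable X]setTI; exact: mP.
  by apply/seteqP; split => y /=; rewrite /xsection/= inE/=; case: (P (x, y)).
by apply/seteqP; split => y /=; rewrite /xsection/= inE/=; case: (P (x, y)).
Qed.

End change_of_var_extra.

(* The canonical sigma-finite structure of [m1 \x m2] is inferred for
   subprobabilities only; the alias below carries the general one. *)
Section product_sigma_finite.
Context d1 d2 (X : measurableType d1) (Y : measurableType d2) (R : realType)
  (m1 : {sigma_finite_measure set X -> \bar R}) (m2 : {sigma_finite_measure set Y -> \bar R}).

Lemma sigma_finite_product : sigma_finite setT (m1 \x m2)%E.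
Proof.
have /sigma_finiteP[F [TF ndF Foo]] := sigma_finiteT m1.
have /sigma_finiteP[G [TG ndG Goo]] := sigma_finiteT m2.
exists (fun n => F n `*` G n).
 rewrite -setXTT TF TG predeqE => -[x y]; split.
    move=> [/= [n _ Fnx] [k _ Gky]]; exists (maxn n k) => //; split.
    - by move: x Fnx; exact/subsetPset/ndF/leq_maxl.
    - by move: y Gky; exact/subsetPset/ndG/leq_maxr.
  by move=> [n _ []/= ? ?]; split; exists n.
move=> k; have [? ?] := Foo k; have [? ?] := Goo k.
split; first exact: measurableX.
by rewrite product_measure1E// lte_mul_pinfty// ge0_fin_numE.
Qed.
Definition sigma_finite_prod : set (X * Y)%type -> \bar R := (product_measure1 m1 m2).
HB.instance Definition _ := Measure.on sigma_finite_prod.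
HB.instance Definition _ := Measure_isSigmaFinite.Build _ _ _ sigma_finite_prod
  sigma_finite_product.
Definition sfprod : {sigma_finite_measure set (X * Y)%type -> \bar R} := sigma_finite_prod.
End product_sigma_finite.

Section lebesgue_space.
Variable R : realType.
Definition lam1 : {sigma_finite_measure set (measurableTypeR R) -> \bar R} :=
  lebesgue_measure.
Definition lam2 := sfprod lam1 lam1.
Definition lam3 := sfprod lam2 lam1.
Definition lam6 := sfprod lam3 lam3.
End lebesgue_space.

(** * Null sets, translations and rank-one maps in R^3 *)

Section space.
Context {R : realType}.
Local Notation lam := (lam1 R).
Local Notation lam2 := (lam2 R).
Local Notation lam3 := (lam3 R).
Local Notation M := (measurableTypeR R).
Local Notation V := (M * M * M)%type.
Implicit Types m x y n : vec R.

Lemma ae_lebesgue_neq (c : R) :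
  {ae lam, forall t, t != c}.
Proof.
exists [set c]; split; [exact: measurable_set1|exact: lebesgue_measure_set1|].
by move=> t /= /negP; rewrite negbK => /eqP.
Qed.

Lemma ae_lam2_neq0 : {ae lam2, forall q, q.2 != 0}.
Proof.
apply: (@ae_prod_snd R _ _ M M lam lam (fun q => q.2 != 0)) => [|x].
  by apply: measurable_neg; apply: measurable_fun_eqr; measurable_tac.
exact: ae_lebesgue_neq.
Qed.

Lemma ae_lam3_neq (c : R) : {ae lam3, forall x, x.2 != c}.
Proof.
apply: (@ae_prod_snd R _ _ (M * M)%type M lam2 lam (fun x => x.2 != c)) => [|x].
  by apply: measurable_neg; apply: measurable_fun_eqr; measurable_tac.
exact: ae_lebesgue_neq.
Qed.

Lemma change_of_var_translate1 (b : R) :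
  change_of_var lam lam (fun t => t + b) (fun=> 1).
Proof.
apply: (change_of_var_eq (change_of_var_affine b (oner_neq0 R))) => t.
  by rewrite mul1r.
by rewrite normr1.
Qed.

Lemma change_of_var_translate2 (a b : R) :
  change_of_var lam2 lam2
    (fun p => (p.1 + a, p.2 + b)) (fun=> 1).
Proof.
apply: change_of_var_eq (change_of_var_pair (change_of_var_translate1 a)
  (change_of_var_translate1 b)) _ _ => // p; exact: mulr1.
Qed.

Lemma change_of_var_translate y :
  change_of_var lam3 lam3 (fun x => vadd x y) (fun=> 1).
Proof.
apply: change_of_var_eq (change_of_var_pair
  (change_of_var_translate2 y.1.1 y.1.2) (change_of_var_translate1 y.2)) _ _.
  by [].
by move=> p; exact: mulr1.
Qed.

(* In the coordinates [(x1, x2, t)] with [t := vdot x m] the map is a shear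
   followed by the scaling [t |-> (1 - c |m|^2) t]. *)
Lemma change_of_var_rank_one m (c : R) : m.2 != 0 -> 1 - c * vdot m m != 0 ->
  change_of_var lam3 lam3
    (fun x => vsub x (vscale (c * vdot x m) m))
    (fun=> `|1 - c * vdot m m|).
Proof.
case: m => -[m1 m2] m3; rewrite /vdot/= => m30 l0; set l := 1 - _ in l0 *.
have cA : change_of_var lam3 lam3
    (fun x : V => (x.1, m3 * x.2 + (x.1.1 * m1 + x.1.2 * m2)))
    (fun=> `|m3|).
  apply: (@change_of_var_snd R _ _ _ (M * M)%type M M lam2 lam lam
    (fun x => m3 * x.2 + (x.1.1 * m1 + x.1.2 * m2))) => //=.
    by measurable_tac.
  by apply: aeW => a; exact: change_of_var_affine.
have cA' : change_of_var lam3 lam3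
    (fun x : V => (x.1, m3^-1 * x.2 + (- (x.1.1 * m1 + x.1.2 * m2) / m3)))
    (fun=> `|m3^-1|).
  apply: (@change_of_var_snd R _ _ _ (M * M)%type M M lam2 lam lam
    (fun x => m3^-1 * x.2 + (- (x.1.1 * m1 + x.1.2 * m2) / m3))) => //=.
    by measurable_tac.
  by apply: aeW => a; apply: change_of_var_affine; rewrite invr_neq0.
have cS : change_of_var lam3 lam3
    (fun x : V => ((x.1.1 + (- c * x.2 * m1), x.1.2 + (- c * x.2 * m2)), x.2))
    (fun=> 1).
  apply: (@change_of_var_fst R _ _ _ M (M * M)%type (M * M)%type lam
    lam2 lam2
    (fun x => (x.1.1 + (- c * x.2 * m1), x.1.2 + (- c * x.2 * m2)))) => //=.
    by measurable_tac.
  by apply: aeW => t; exact: change_of_var_translate2.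
have cL : change_of_var lam3 lam3
    (fun x : V => (x.1, l * x.2 + 0)) (fun=> `|l|).
  apply: (@change_of_var_snd R _ _ _ (M * M)%type M M lam2 lam lam
    (fun x => l * x.2 + 0)) => //=.
    by measurable_tac.
  by apply: aeW => a; exact: change_of_var_affine.
apply: change_of_var_eq (change_of_var_comp cA (change_of_var_comp cS
  (change_of_var_comp cL cA'))) _ _.
  move=> [[x1 x2] x3]; rewrite /vsub /vscale /vadd/= /l.
  by congr (_, _, _); try ring; field.
by move=> x; rewrite mulr1 -!normrM; congr (`|_|); field.
Qed.

End space.

(** * Linear maps of phase space *)

Section vectors.
Context {R : realType}.
Implicit Types x y n k : vec R.

Lemma vdot_ge0 x : 0 <= vdot x x.
Proof. by rewrite /vdot -!expr2 !addr_ge0// sqr_ge0. Qed.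

Lemma vdot_gt0 x : x.2 != 0 -> 0 < vdot x x.
Proof.
move=> x20; rewrite /vdot -!expr2; apply: ltr_wpDl.
  by rewrite addr_ge0// sqr_ge0.
by rewrite lt_neqAle sqr_ge0 eq_sym expf_neq0.
Qed.

Lemma sqr_vnorm x : vnorm x ^+ 2 = vdot x x.
Proof. by rewrite sqr_sqrtr// vdot_ge0. Qed.

Lemma vnorm_gt0 x : x.2 != 0 -> 0 < vnorm x.
Proof. by move=> x20; rewrite sqrtr_gt0 vdot_gt0. Qed.

Lemma vdotZl (a : R) x y : vdot (vscale a x) y = a * vdot x y.
Proof. by rewrite /vdot/=; ring. Qed.

Lemma vdotZr (a : R) x y : vdot x (vscale a y) = a * vdot x y.
Proof. by rewrite /vdot/=; ring. Qed.

Lemma vdot_unit x : 0 < vnorm x -> vdot (vunit x) (vunit x) = 1.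
Proof.
move=> x0; rewrite /vunit vdotZl vdotZr -sqr_vnorm; field; exact: lt0r_neq0.
Qed.

Lemma vunitZ (a : R) x : 0 < a -> vunit (vscale a x) = vunit x.
Proof.
move=> a0; rewrite /vunit /vnorm vdotZl vdotZr mulrA -expr2 sqrtrM ?sqr_ge0//.
rewrite sqrtr_sqr gtr0_norm// invfM; case: x => -[x1 x2] x3.
rewrite /vscale/=; set i := (Num.sqrt _)^-1.
by congr (_, _, _); field; rewrite gt_eqF.
Qed.

Lemma vunit1 x : vdot x x = 1 -> vunit x = x.
Proof.
move=> x1; rewrite /vunit /vnorm x1 sqrtr1 invr1.
by case: x {x1} => -[? ?] ?; rewrite /vscale/= !mul1r.
Qed.

Lemma vnorm1 x : vdot x x = 1 -> vnorm x = 1.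
Proof. by move=> x1; rewrite /vnorm x1 sqrtr1. Qed.

End vectors.

Section reflection.
Context {R : realType}.
Local Notation M := (measurableTypeR R).
Local Notation V := (M * M * M)%type.
Implicit Types (x y n m : vec R) (p : vec R * vec R).

(** One family for the law and its inverse: c = (1 + e)/2 gives [Cr], and c = (1 + 1/e)/2 gives
    [Cr_inv]. For unit n, the component of the relative velocity along n is multiplied by 1 - 2c. *)
Definition collide (c : R) n p : vec R * vec R :=
  let d := vscale (c * vdot (vsub p.1 p.2) n) n in
  (vsub p.1 d, vadd p.2 d).

(** In the coordinates (u, w) with u = v - w, the map is the rank-one map u |-> u - 2c (u . n) n
    followed by a translation of w that depends on u. Only the rank-one map changes volume. *)
Lemma change_of_var_collide (c : R) n :
  n.2 != 0 -> vdot n n = 1 -> 1 - 2 * c != 0 ->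
  change_of_var (lam6 R) (lam6 R) (collide c n) (fun=> `|1 - 2 * c|).
Proof.
move=> n20 n1 c0.
have fst_cov (T : V * V -> V) (r : R) : 0 <= r ->
    measurable_fun [set: V * V] T ->
    (forall w, change_of_var (lam3 R) (lam3 R) (fun v => T (v, w)) (fun=> r)) ->
    change_of_var (lam6 R) (lam6 R) (fun p => (T p, p.2)) (fun=> r).
  move=> r0 mT TE.
  by apply: (@change_of_var_fst R _ _ _ V V V (lam3 R) (lam3 R) (lam3 R) T) => //;
    apply: aeW.
have c1 : change_of_var (lam6 R) (lam6 R)
    (fun p : V * V => (vadd p.1 (vscale (-1) p.2), p.2)) (fun=> 1).
  apply: (fst_cov (fun p => vadd p.1 (vscale (-1) p.2))) => //.
    by measurable_vec.
  by move=> w; exact: (change_of_var_translate (vscale (-1) w)).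
have c2 : change_of_var (lam6 R) (lam6 R)
    (fun p : V * V => (vsub p.1 (vscale (2 * c * vdot p.1 n) n), p.2))
    (fun=> `|1 - 2 * c|).
  apply: (fst_cov (fun p => vsub p.1 (vscale (2 * c * vdot p.1 n) n))) => //.
    by measurable_vec.
  move=> w; have := @change_of_var_rank_one R n (2 * c) n20.
  by rewrite n1 mulr1; apply.
(* Here u has already been transformed, so its normal component carries a factor 1 - 2c that the
   coefficient divides out. *)
have c3 : change_of_var (lam6 R) (lam6 R)
    (fun p : V * V => (p.1, vadd p.2 (vscale (c / (1 - 2 * c) * vdot p.1 n) n)))
    (fun=> 1).
  apply: (@change_of_var_snd R _ _ _ V V V (lam3 R) (lam3 R) (lam3 R)
    (fun p => vadd p.2 (vscale (c / (1 - 2 * c) * vdot p.1 n) n))) => //.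
    by measurable_vec.
  by apply: aeW => u;
    exact: (change_of_var_translate (vscale (c / (1 - 2 * c) * vdot u n) n)).
have c4 : change_of_var (lam6 R) (lam6 R)
    (fun p : V * V => (vadd p.1 p.2, p.2)) (fun=> 1).
  apply: (fst_cov (fun p => vadd p.1 p.2)) => //.
    by measurable_vec.
  by move=> w; exact: (change_of_var_translate w).
apply: change_of_var_eq (change_of_var_comp c1 (change_of_var_comp c2
  (change_of_var_comp c3 c4))) _ _; last by move=> p; rewrite !mul1r mulr1.
move=> [v w]; rewrite /collide/=.
set u := vadd v (vscale (-1) w).
have -> : vdot (vsub u (vscale (2 * c * vdot u n) n)) n = (1 - 2 * c) * vdot u n.
  transitivity (vdot u n - 2 * c * vdot u n * vdot n n); last by rewrite n1; ring.
  by rewrite /vdot /vsub /vadd /vscale/=; ring.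
have -> : c / (1 - 2 * c) * ((1 - 2 * c) * vdot u n) = c * vdot u n by field.
rewrite /u.
by congr (_, _); rewrite /vsub /vadd /vscale /vdot/=; congr (_, _, _); ring.
Qed.

End reflection.

(** * The map n |-> S_n k on the sphere *)

Section sphere.
Context {R : realType}.
Local Notation M := (measurableTypeR R).
Local Notation V := (M * M * M)%type.
Implicit Types (x y n k : vec R).

Definition mirror n k : vec R := vsub k (vscale (2 * vdot k n) n).

(** A weight in place of the domain [cone_dom], since changes of variables are stated over whole
    spaces. *)
Definition ball_ind x : R := if 0 < vnorm x <= 1 then 1 else 0.

Lemma ball_ind_ge0 x : 0 <= ball_ind x.
Proof. by rewrite /ball_ind; case: ifP. Qed.

Lemma measurable_ball_ind : measurable_fun [set: V] (ball_ind : V -> R).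
Proof. rewrite /ball_ind; measurable_vec. Qed.

Lemma vnormZ (a : R) x : vnorm (vscale a x) = `|a| * vnorm x.
Proof.
by rewrite /vnorm vdotZl vdotZr mulrA -expr2 sqrtrM ?sqr_ge0// sqrtr_sqr.
Qed.

Lemma mirror_unit y k : 0 < vnorm y ->
  mirror (vunit y) k = vsub k (vscale (2 * vdot k y / vdot y y) y).
Proof.
move=> y0; have y0' := lt0r_neq0 y0.
rewrite /mirror /vunit vdotZr -sqr_vnorm; set i := vnorm y in y0' *.
rewrite /vsub /vadd /vscale/=.
by congr (_, _, _); field.
Qed.

Lemma change_of_var_scale2 (a : R) : a != 0 ->
  change_of_var (lam2 R) (lam2 R)
    (fun q : M * M => (a * q.1, a * q.2)) (fun=> a ^+ 2).
Proof.
move=> a0; have ca := change_of_var_affine 0 a0.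
apply: change_of_var_eq (change_of_var_pair ca ca) _ _ => q.
  by rewrite !addr0.
by rewrite -expr2 -normrX ger0_norm// sqr_ge0.
Qed.

(** On the point (q, t), a = 1 gives t (q, 1), and a = -2 gives the horizontal part of t
    [paraboloid] q. The slice t = 0, where the map degenerates, is null. *)
Lemma change_of_var_gnomonic (a : R) : a != 0 ->
  change_of_var (lam3 R) (lam3 R)
    (fun x : V => ((a * x.2 * x.1.1, a * x.2 * x.1.2), x.2))
    (fun x => (a * x.2) ^+ 2).
Proof.
move=> a0.
apply: (@change_of_var_fst R _ _ _ M (M * M)%type (M * M)%type (lam1 R)
  (lam2 R) (lam2 R) (fun x : V => (a * x.2 * x.1.1, a * x.2 * x.1.2))
  (fun x => (a * x.2) ^+ 2)).
- measurable_tac.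
- measurable_tac.
- by move=> p; exact: sqr_ge0.
- apply: ae_imp (ae_lebesgue_neq 0) _ => t t0 /=.
  by apply: change_of_var_scale2; rewrite mulf_neq0.
Qed.

(* The stereographic image of [q] is [vunit (paraboloid q)], which is also
   [mirror n pole] for the gnomonic direction [n = vunit (q, 1)]. *)
Definition paraboloid (q : R * R) : vec R :=
  ((-2 * q.1, -2 * q.2), q.1 ^+ 2 + q.2 ^+ 2 - 1).

(** The horizontal part y = -2 t q has |y|^2 = 4 t^2 |q|^2, so the height |y|^2 / (4 t) - t equals t
    (|q|^2 - 1). The Jacobian is 4 t^2 from the scaling times |q|^2 + 1 from the height. Positive t
    suffice, as q already parametrizes almost all directions. *)
Lemma change_of_var_stereographic :
  change_of_var (lam3 R) (lam3 R)
    (fun x : V => vscale x.2 (paraboloid x.1))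
    (fun x => if 0 < x.2 then 4 * x.2 ^+ 2 * (1 + (x.1.1 ^+ 2 + x.1.2 ^+ 2))
              else 0).
Proof.
have n20 : -2 != 0 :> R by rewrite oppr_eq0 pnatr_eq0.
have cH : change_of_var (lam3 R) (lam3 R)
    (fun x : V => (x.1, (x.1.1 ^+ 2 + x.1.2 ^+ 2) / (4 * x.2) - x.2))
    (fun x => if 0 < x.2 then (x.1.1 ^+ 2 + x.1.2 ^+ 2) / (4 * x.2 ^+ 2) + 1
              else 0).
  apply: (@change_of_var_snd R _ _ _ (M * M)%type M M (lam2 R) (lam1 R) (lam1 R)
    (fun x : V => (x.1.1 ^+ 2 + x.1.2 ^+ 2) / (4 * x.2) - x.2)
    (fun x : V =>
      if 0 < x.2 then (x.1.1 ^+ 2 + x.1.2 ^+ 2) / (4 * x.2 ^+ 2) + 1 else 0)).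
  - measurable_tac.
  - measurable_tac.
  - move=> x; case: ifPn => // x0; rewrite addr_ge0// divr_ge0//.
      by rewrite addr_ge0// sqr_ge0.
    by rewrite mulr_ge0// sqr_ge0.
  - apply: ae_imp ae_lam2_neq0 _ => q q0.
    have c0 : 0 < q.1 ^+ 2 + q.2 ^+ 2.
      by rewrite ltr_wpDl ?sqr_ge0// lt_neqAle sqr_ge0 eq_sym expf_neq0.
    exact: (change_of_var_height c0).
apply: change_of_var_eq (change_of_var_comp (change_of_var_gnomonic n20) cH) _ _.
  move=> [[p1 p2] t]; rewrite /vscale /paraboloid/=.
  (* At t = 0 both sides are the zero vector, because division by 0 yields 0. *)
  have [->|t0] := eqVneq t 0; first by rewrite !(mulr0, mul0r, invr0, subr0).
  by congr (_, _, _); try ring; field.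
move=> [[p1 p2] t]/=; case: ifPn => [t0|_]; last by rewrite mul0r.
by field; exact: lt0r_neq0.
Qed.

End sphere.

(** * Spherical integrals in stereographic and gnomonic coordinates *)

Section sphere_integral.
Context {R : realType}.
Local Notation M := (measurableTypeR R).
Local Notation V := (M * M * M)%type.
Implicit Types (x y n k : vec R).
Local Open Scope ereal_scope.

(** The cone measure without its factor 3, hence a third of the surface integral. *)
Definition sphere_integral (f : V -> \bar R) : \bar R :=
  \int[lam3 R]_x (f (vunit x) * (ball_ind x)%:E).

Lemma measurable_sphere_integrand (f : V -> \bar R) :
  measurable_fun [set: V] f ->
  measurable_fun [set: V] (fun x : V => f (vunit x) * (ball_ind x)%:E).
Proof.
move=> mf; apply: emeasurable_funM.
  have mu : measurable_fun [set: V] (fun x : V => vunit x : V) by measurable_vec.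
  exact: (measurableT_comp mf mu).
apply/measurable_EFinP; exact: measurable_ball_ind.
Qed.

Lemma integral_lam3_iterated (F : V -> \bar R) (T : V -> V) (J : V -> R) :
  measurable_fun [set: V] F -> (forall x, 0 <= F x) ->
  change_of_var (lam3 R) (lam3 R) T J ->
  \int[lam3 R]_x F x =
  \int[lam2 R]_q \int[lam1 R]_t (F (T (q, t)) * (J (q, t))%:E).
Proof.
move=> mF F0 [mT mJ J0 TE]; rewrite TE//.
apply: (@fubini_tonelli1 _ _ _ _ R (lam2 R) (lam1 R)
  (fun x => F (T x) * (J x)%:E)).
  apply: emeasurable_funM; first exact: measurableT_comp.
  exact/measurable_EFinP.
by move=> x; rewrite mule_ge0 ?lee_fin.
Qed.

Lemma integral_scaled_sqr (A : \bar R) (c a b : R) :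
  0 <= A -> (0 <= c)%R -> (a < b)%R ->
  \int[lam1 R]_t (A * (c * if (a <= t <= b)%R then t ^+ 2 else 0)%:E) =
  A * (c * ((b ^+ 3 - a ^+ 3) / 3))%:E.
Proof.
move=> A0 c0 ab; pose g (t : M) : R := if (a <= t <= b)%R then (t ^+ 2)%R else 0%R.
have g0 t : (0 <= g t)%R by rewrite /g; case: ifP => // _; exact: sqr_ge0.
have mg : measurable_fun [set: M] (g : M -> R) by rewrite /g; measurable_tac.
rewrite ge0_integralZl//.
- under eq_integral do rewrite EFinM.
  rewrite ge0_integralZl//.
  + by rewrite [X in _ * (_ * X)](integral_sqr ab).
  + exact/measurable_EFinP.
  + by move=> t _; rewrite lee_fin; exact: g0.
- by apply/measurable_EFinP; apply: measurable_funM.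
- by move=> t _; rewrite lee_fin mulr_ge0//; exact: g0.
Qed.

Definition pole : vec R := ((0, 0), 1)%R.

Lemma vdot_paraboloid (q : R * R) :
  vdot (paraboloid q) (paraboloid q) = ((1 + (q.1 ^+ 2 + q.2 ^+ 2)) ^+ 2)%R.
Proof. by rewrite /vdot/=; ring. Qed.

(** With w = 1 + |q|^2 = |[paraboloid] q|, the radial integral of 4 w t^2 over [0, 1/w] is 4 / (3
    w^2). *)
Lemma sphere_integral_stereographic (f : V -> \bar R) :
  measurable_fun [set: V] f -> (forall x, 0 <= f x) ->
  sphere_integral f = \int[lam2 R]_q (f (vunit (paraboloid q)) *
    (4 / 3 * (1 + (q.1 ^+ 2 + q.2 ^+ 2)) ^- 2)%:E).
Proof.
move=> mf f0.
have F0 x : 0 <= f (vunit x) * (ball_ind x)%:E.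
  by rewrite mule_ge0// lee_fin ball_ind_ge0.
rewrite /sphere_integral (integral_lam3_iterated
  (measurable_sphere_integrand mf) F0 change_of_var_stereographic).
apply: eq_integral => -[p1 p2] _ /=.
set w := (1 + (p1 ^+ 2 + p2 ^+ 2))%R.
have w0 : (0 < w)%R by rewrite ltr_wpDr// addr_ge0// sqr_ge0.
have nq : vnorm (paraboloid (p1, p2)) = w.
  by rewrite /vnorm vdot_paraboloid/= sqrtr_sqr gtr0_norm.
transitivity (\int[lam1 R]_t (f (vunit (paraboloid (p1, p2))) *
    (4 * w * if (0 <= t <= w^-1)%R then t ^+ 2 else 0)%:E)).
  apply: eq_integral => t _; case: ifPn => t0; last first.
    rewrite mule0; case: ifPn => [/andP[t0' _]|_]; last by rewrite mulr0 mule0.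
    have -> : t = 0%R by apply/le_anti; rewrite t0' leNgt t0.
    by rewrite expr0n/= mulr0 mule0.
  rewrite vunitZ// -muleA -EFinM; congr (_ * _%:E).
  rewrite /ball_ind vnormZ nq gtr0_norm// mulr_gt0//= (ltW t0)/=.
  rewrite -ler_pdivlMr// mul1r; case: ifPn => _; ring.
rewrite integral_scaled_sqr ?invr_gt0//; last by rewrite mulr_ge0// ltW.
by congr (_ * _%:E); field; exact: lt0r_neq0.
Qed.

(** With w = 1 + |q|^2, the radial integral of t^2 over |t| <= 1 / sqrt w is 2 / (3 w^(3/2)). Both
    signs of t give the same [H q]: this is where n and -n are identified and the two-to-one map is
    counted correctly. *)
Lemma sphere_integral_gnomonic (h : V -> \bar R) (H : R * R -> \bar R) :
  measurable_fun [set: V] h -> (forall x, 0 <= h x) -> (forall q, 0 <= H q) ->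
  (forall q t, t != 0%R ->
    h (vunit (vscale t (q, 1%R))) = H q) ->
  sphere_integral h = \int[lam2 R]_q (H q *
    (2 / 3 * (Num.sqrt (1 + (q.1 ^+ 2 + q.2 ^+ 2))) ^- 3)%:E).
Proof.
move=> mh h0 H0 hH.
have F0 x : 0 <= h (vunit x) * (ball_ind x)%:E.
  by rewrite mule_ge0// lee_fin ball_ind_ge0.
rewrite /sphere_integral (integral_lam3_iterated
  (measurable_sphere_integrand mh) F0 (change_of_var_gnomonic (oner_neq0 R))).
apply: eq_integral => -[p1 p2] _ /=.
set w := (1 + (p1 ^+ 2 + p2 ^+ 2))%R.
have w0 : (0 < w)%R by rewrite ltr_wpDr// addr_ge0// sqr_ge0.
have sw0 : (0 < Num.sqrt w)%R by rewrite sqrtr_gt0.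
have nq : vnorm ((p1, p2), 1%R) = Num.sqrt w.
  by rewrite /vnorm /vdot/= /w; congr Num.sqrt; ring.
transitivity (\int[lam1 R]_t (H (p1, p2) *
    (1 * if (- (Num.sqrt w)^-1 <= t <= (Num.sqrt w)^-1)%R then t ^+ 2 else 0)%:E)).
  apply: eq_integral => t _.
  rewrite (_ : ((1 * t * p1, 1 * t * p2), t)%R = vscale t ((p1, p2), 1)%R);
    last by rewrite /vscale/=; congr (_, _, _); ring.
  rewrite !mul1r; have [->|t0] := eqVneq t 0%R.
    by rewrite expr0n/= if_same !mule0.
  rewrite hH// -muleA -EFinM; congr (_ * _%:E).
  rewrite /ball_ind vnormZ nq mulr_gt0 ?normr_gt0//=.
  rewrite -ler_pdivlMr// mul1r ler_norml; case: ifPn => _; ring.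
rewrite integral_scaled_sqr//; last by rewrite gtrN ?invr_gt0.
by congr (_ * _%:E); field; exact: lt0r_neq0.
Qed.

Lemma measurable_mirror (k : vec R) :
  measurable_fun [set: V] (fun n : V => mirror n k : V).
Proof. rewrite /mirror; measurable_vec. Qed.

Lemma measurable_mirror_weight (f : V -> \bar R) k :
  measurable_fun [set: V] f ->
  measurable_fun [set: V] (fun n : V => f (mirror n k) * (2 * `|vdot k n|)%:E).
Proof.
move=> mf; apply: emeasurable_funM.
  exact: (measurableT_comp mf (measurable_mirror k)).
apply/measurable_EFinP; measurable_vec.
Qed.

(** The two radial densities have ratio 2 / sqrt w with w = 1 + |q|^2, and this is the weight 2
    |pole . n| at n = (q, 1) / sqrt w. *)
Lemma sphere_integral_mirror_pole (f : V -> \bar R) :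
  measurable_fun [set: V] f -> (forall x, 0 <= f x) ->
  sphere_integral f =
  sphere_integral (fun n => f (mirror n pole) * (2 * `|vdot pole n|)%:E).
Proof.
move=> mf f0; rewrite sphere_integral_stereographic//.
pose W (q : R * R) := (1 + (q.1 ^+ 2 + q.2 ^+ 2))%R.
have W0 q : (0 < W q)%R by rewrite ltr_wpDr// addr_ge0// sqr_ge0.
rewrite (@sphere_integral_gnomonic _ (fun q => f (vunit (paraboloid q)) *
    (2 * (Num.sqrt (W q))^-1)%:E)).
- apply: eq_integral => q _; rewrite -muleA -EFinM; congr (_ * _%:E).
  rewrite -/(W q) -[X in (X ^- 2)%R](@sqr_sqrtr _ (W q)) ?ltW//.
  by field; rewrite gt_eqF// sqrtr_gt0.
- exact: measurable_mirror_weight.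
- by move=> x; rewrite mule_ge0// lee_fin mulr_ge0.
- by move=> q; rewrite mule_ge0// lee_fin mulr_ge0// invr_ge0 sqrtr_ge0.
- move=> q t t0.
  have nq : vdot (vscale t (q, 1%R)) (vscale t (q, 1%R)) = (t ^+ 2 * W q)%R.
    by rewrite /vdot /W/=; ring.
  have n0 : (0 < vnorm (vscale t (q, 1%R)))%R.
    by rewrite /vnorm nq sqrtr_gt0 mulr_gt0// lt_neqAle sqr_ge0 eq_sym expf_neq0.
  rewrite mirror_unit//; congr (f _ * _%:E).
    have np : vnorm (paraboloid q) = W q.
      by rewrite /vnorm vdot_paraboloid sqrtr_sqr -/(W q) gtr0_norm.
    have Wq := lt0r_neq0 (W0 q); rewrite /vunit np nq.
    move: Wq; rewrite /W => Wq; case: q {nq n0 np} Wq => q1 q2/= Wq.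
    rewrite /vsub /vadd /vscale /paraboloid /vdot/=.
    by congr (_, _, _); field; rewrite Wq t0.
  rewrite /vunit vdotZr normrM normrV ?unitfE ?gt_eqF// gtr0_norm//.
  rewrite {1}/vnorm nq sqrtrM ?sqr_ge0// sqrtr_sqr.
  rewrite (_ : vdot pole _ = t); last by rewrite /vdot/=; ring.
  by field; rewrite normr_eq0 t0 gt_eqF// sqrtr_gt0.
Qed.

End sphere_integral.

(** * The mirror map for an arbitrary axis *)

Section sphere_integral_mirror.
Context {R : realType}.
Local Notation M := (measurableTypeR R).
Local Notation V := (M * M * M)%type.
Implicit Types (x y n k : vec R).

(** Unlike [mirror], it divides by |m|^2: the Householder normal k - pole is not a unit vector. *)
Definition reflect (m x : vec R) : vec R :=
  vsub x (vscale (2 / vdot m m * vdot x m) m).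

Lemma reflectZ m (a : R) x : reflect m (vscale a x) = vscale a (reflect m x).
Proof.
rewrite /reflect vdotZl /vsub /vadd /vscale/=; set i := 2 / _.
by congr (_, _, _); ring.
Qed.

Lemma reflectB m x y : reflect m (vsub x y) = vsub (reflect m x) (reflect m y).
Proof.
rewrite /reflect; set i := 2 / _; rewrite /vdot /vsub /vadd /vscale/=.
by congr (_, _, _); ring.
Qed.

Lemma vdot_reflect m x y : vdot m m != 0 ->
  vdot (reflect m x) (reflect m y) = vdot x y.
Proof.
move=> m0; rewrite /reflect.
transitivity (vdot x y - 2 * (2 / vdot m m) * vdot x m * vdot y m +
    (2 / vdot m m) ^+ 2 * vdot x m * vdot y m * vdot m m); last by field.
by set i := 2 / _; rewrite /vdot /vsub /vadd /vscale/=; ring.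
Qed.

Lemma vunit_reflect m x : vdot m m != 0 ->
  vunit (reflect m x) = reflect m (vunit x).
Proof. by move=> m0; rewrite /vunit /vnorm vdot_reflect// reflectZ. Qed.

Lemma mirror_reflect m n k : vdot m m != 0 ->
  mirror (reflect m n) (reflect m k) = reflect m (mirror n k).
Proof. by move=> m0; rewrite /mirror vdot_reflect// reflectB reflectZ. Qed.

Lemma change_of_var_reflect m : m.2 != 0 ->
  change_of_var (lam3 R) (lam3 R) (reflect m) (fun=> 1).
Proof.
move=> m20; have m0 := lt0r_neq0 (vdot_gt0 m20).
have E : 1 - 2 / vdot m m * vdot m m = -1 by rewrite divfK//; ring.
apply: change_of_var_eq (@change_of_var_rank_one R m (2 / vdot m m) m20 _) _ _.
- by rewrite E oppr_eq0 oner_eq0.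
- by [].
- by move=> x; rewrite E normrN normr1.
Qed.

Lemma measurable_reflect m : measurable_fun [set: V] (reflect m : V -> V).
Proof. rewrite /reflect; measurable_vec. Qed.

Lemma sphere_integral_reflect m (f : V -> \bar R) : m.2 != 0 ->
  measurable_fun [set: V] f -> (forall x, 0 <= f x)%E ->
  sphere_integral f = sphere_integral (fun n => f (reflect m n)).
Proof.
move=> m20 mf f0; have m0 := lt0r_neq0 (vdot_gt0 m20).
rewrite {1}/sphere_integral; have [_ _ _ ->] := change_of_var_reflect m20.
- apply: eq_integral => x _; rewrite mule1 vunit_reflect//.
  by rewrite /ball_ind /vnorm vdot_reflect.
- exact: measurable_sphere_integrand.
- by move=> x; rewrite mule_ge0// lee_fin ball_ind_ge0.
Qed.

Lemma sphere_integral_mirror k (f : V -> \bar R) : vdot k k = 1 ->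
  measurable_fun [set: V] f -> (forall x, 0 <= f x)%E ->
  sphere_integral f =
  sphere_integral (fun n => f (mirror n k) * (2 * `|vdot k n|)%:E)%E.
Proof.
move=> k1 mf f0; have [->|kpole] := eqVneq k (pole : vec R).
  exact: sphere_integral_mirror_pole.
(* A unit vector with last coordinate 1 is the pole; otherwise k - pole has the nonzero third
   coordinate that the shears require. *)
have k21 : k.2 - 1 != 0.
  apply: contra kpole; rewrite subr_eq0; move: k1; case: k => -[a b] c.
  rewrite /vdot/= => + /eqP c1; rewrite c1 => abE.
  have a2 := sqr_ge0 a; have b2 := sqr_ge0 b.
  have a0 : a ^+ 2 = 0 by apply/le_anti; rewrite a2 andbT; lra.
  have b0 : b ^+ 2 = 0 by apply/le_anti; rewrite b2 andbT; lra.
  move/eqP: a0; move/eqP: b0; rewrite !sqrf_eq0 => /eqP -> /eqP ->.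
  by rewrite /pole.
pose m := vsub k (pole : vec R).
have m20 : m.2 != 0 by rewrite /m /= mulN1r.
have m0 := lt0r_neq0 (vdot_gt0 m20).
have mE : vdot m m = - (2 * vdot (pole : vec R) m).
  transitivity (vdot k k + 1 - 2 * k.2); first by rewrite /m /vdot/=; ring.
  by rewrite k1 /m /vdot/=; ring.
have pk : reflect m pole = k.
  (* As k and the pole have equal length, |m|^2 = -2 (pole . m). The coefficient is thus -1, and the
     pole goes to pole + m = k. *)
  rewrite /reflect (_ : 2 / _ * _ = -1).
    rewrite /m; case: (k) => -[a b] c.
    by rewrite /vsub /vadd /vscale/=; congr (_, _, _); ring.
  by apply: (mulIf m0); rewrite mulrAC divfK// mE; ring.
have fr0 x : (0 <= f (reflect m x))%E by [].
have mfr : measurable_fun [set: V] (fun x : V => f (reflect m x)).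
  exact: (measurableT_comp mf (measurable_reflect m)).
rewrite (sphere_integral_reflect m20 mf f0) (sphere_integral_mirror_pole mfr fr0).
rewrite [RHS](sphere_integral_reflect m20).
- congr sphere_integral; apply/funext => n.
  by rewrite -pk mirror_reflect// vdot_reflect.
- exact: measurable_mirror_weight.
- by move=> x; rewrite mule_ge0// lee_fin mulr_ge0.
Qed.

End sphere_integral_mirror.

(** * Integrals over pairs of velocities and the sphere *)

Section xi.
Context {R : realType}.
Local Notation M := (measurableTypeR R).
Local Notation V := (M * M * M)%type.
Implicit Types (p : vec R * vec R) (n : vec R).
Local Open Scope ereal_scope.

Definition lam9 := sfprod (lam6 R) (lam3 R).

Definition xi_integral (F : (V * V) * V -> \bar R) : \bar R :=
  \int[lam9]_q (F (q.1, vunit q.2) * (ball_ind q.2)%:E).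

Lemma measurable_xi_integrand (F : (V * V) * V -> \bar R) :
  measurable_fun [set: (V * V) * V] F ->
  measurable_fun [set: (V * V) * V]
    (fun q : (V * V) * V => F (q.1, vunit q.2) * (ball_ind q.2)%:E).
Proof.
move=> mF; apply: emeasurable_funM.
  have mu : measurable_fun [set: (V * V) * V]
    (fun q : (V * V) * V => (q.1, vunit q.2) : (V * V) * V) by measurable_vec.
  exact: (measurableT_comp mF mu).
apply/measurable_EFinP.
exact: (measurableT_comp measurable_ball_ind measurable_snd).
Qed.

Lemma xi_integralE (F : (V * V) * V -> \bar R) :
  measurable_fun [set: (V * V) * V] F -> (forall q, 0 <= F q) ->
  xi_integral F = \int[lam6 R]_p sphere_integral (fun n => F (p, n)).
Proof.
move=> mF F0.
apply: (@fubini_tonelli1 _ _ _ _ R (lam6 R) (lam3 R)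
  (fun q => F (q.1, vunit q.2) * (ball_ind q.2)%:E)).
  exact: measurable_xi_integrand.
by move=> x; rewrite mule_ge0// lee_fin ball_ind_ge0.
Qed.

Lemma eq_sphere_integral (f g : V -> \bar R) :
  (forall n, vdot n n = 1%R -> f n = g n) -> sphere_integral f = sphere_integral g.
Proof.
move=> fg; apply: eq_integral => x _; rewrite /ball_ind; case: ifPn => [|_].
  by move=> /andP[x0 _]; rewrite fg// vdot_unit.
by rewrite !mule0.
Qed.

(** This is stronger than u != 0 but easier to slice: for each v it excludes a single value of the
    third coordinate of w. *)
Lemma ae_relative_velocity_neq0 :
  {ae lam6 R, forall p, (vsub p.1 p.2 : vec R).2 != 0%R}.
Proof.
apply: (@ae_prod_snd R _ _ V V (lam3 R) (lam3 R)
  (fun p => (vsub p.1 p.2 : vec R).2 != 0%R)) => [|v].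
  apply: measurable_neg; apply: measurable_fun_eqr; last exact: measurable_cst.
  apply: measurable_fun_snd; measurable_vec.
apply: ae_imp (ae_lam3_neq v.2) _ => w; apply: contra => /eqP/= h.
by apply/eqP; move: h; lra.
Qed.

Lemma measurable_sphere_integral (F : (V * V) * V -> \bar R) :
  measurable_fun [set: (V * V) * V] F -> (forall q, 0 <= F q) ->
  measurable_fun [set: V * V] (fun p => sphere_integral (fun n => F (p, n))).
Proof.
move=> mF F0.
apply: (@measurable_fun_fubini_tonelli_F _ _ _ _ R (lam3 R)
  (fun q => F (q.1, vunit q.2) * (ball_ind q.2)%:E)).
  exact: measurable_xi_integrand.
by move=> x; rewrite mule_ge0// lee_fin ball_ind_ge0.
Qed.

Lemma ae_eq_xi_integral (F G : (V * V) * V -> \bar R) :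
  measurable_fun [set: (V * V) * V] F -> (forall q, 0 <= F q) ->
  measurable_fun [set: (V * V) * V] G -> (forall q, 0 <= G q) ->
  (forall p, (vsub p.1 p.2 : vec R).2 != 0%R ->
    sphere_integral (fun n => F (p, n)) = sphere_integral (fun n => G (p, n))) ->
  xi_integral F = xi_integral G.
Proof.
move=> mF F0 mG G0 FG; rewrite (xi_integralE mF F0) (xi_integralE mG G0).
have S0 H p : (forall q, 0 <= H q) -> 0 <= sphere_integral (fun n => H (p, n)).
  by move=> H0; apply: integral_ge0 => x _; rewrite mule_ge0// lee_fin ball_ind_ge0.
apply: ge0_ae_eq_integral.
- exact: measurableT.
- exact: measurable_sphere_integral mF F0.
- exact: measurable_sphere_integral mG G0.
- by move=> p _; exact: S0.
- by move=> p _; exact: S0.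
by apply: ae_imp ae_relative_velocity_neq0 _ => p p0 _; exact: FG.
Qed.

Definition mirror_direction (q : (V * V) * V) : (V * V) * V :=
  (q.1, mirror q.2 (vunit (vsub q.1.1 q.1.2))).

Definition mirror_weight (q : (V * V) * V) : R :=
  2 * `|vdot (vunit (vsub q.1.1 q.1.2)) q.2|.

Lemma measurable_mirror_direction (F : (V * V) * V -> \bar R) :
  measurable_fun [set: (V * V) * V] F ->
  measurable_fun [set: (V * V) * V]
    (fun q => F (mirror_direction q) * (mirror_weight q)%:E).
Proof.
move=> mF; apply: emeasurable_funM.
  have mm : measurable_fun [set: (V * V) * V] mirror_direction.
    rewrite /mirror_direction /mirror; measurable_vec.
  exact: (measurableT_comp mF mm).
apply/measurable_EFinP; rewrite /mirror_weight; measurable_vec.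
Qed.

Lemma xi_integral_mirror (F : (V * V) * V -> \bar R) :
  measurable_fun [set: (V * V) * V] F -> (forall q, 0 <= F q) ->
  xi_integral F =
  xi_integral (fun q => F (mirror_direction q) * (mirror_weight q)%:E).
Proof.
move=> mF F0; apply: ae_eq_xi_integral => //.
- exact: measurable_mirror_direction.
- by move=> q; rewrite mule_ge0// lee_fin mulr_ge0.
- move=> p p0; have k1 := vdot_unit (vnorm_gt0 p0).
  have mFp := measurable_fun_pair2 p mF.
  exact: (sphere_integral_mirror k1 mFp).
Qed.

Definition collide_fst (c : R) (q : (V * V) * V) : (V * V) * V :=
  (collide c q.2 q.1, q.2).

Lemma measurable_collide_fst (c : R) :
  measurable_fun [set: (V * V) * V] (collide_fst c).
Proof. rewrite /collide_fst /collide; measurable_vec. Qed.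

(** The sphere variable is left fixed, so on almost every slice the linear map of R^6 acts with
    constant Jacobian. *)
Lemma xi_integral_collide (c : R) (F : (V * V) * V -> \bar R) :
  (1 - 2 * c != 0)%R ->
  measurable_fun [set: (V * V) * V] F -> (forall q, 0 <= F q) ->
  xi_integral F = xi_integral (fun q => F (collide_fst c q) * `|1 - 2 * c|%:E).
Proof.
move=> c0 mF F0.
have cc : change_of_var lam9 lam9
    (fun q : (V * V) * V => (collide c (vunit q.2) q.1, q.2)) (fun=> `|1 - 2 * c|%R).
  apply: (@change_of_var_fst R _ _ _ V (V * V)%type (V * V)%type (lam3 R)
    (lam6 R) (lam6 R) (fun q : (V * V) * V => collide c (vunit q.2) q.1)) => //.
    rewrite /collide; measurable_vec.
  apply: ae_imp (ae_lam3_neq 0) _ => x x0 /=.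
  have n0 := vnorm_gt0 x0.
  apply: change_of_var_collide => //; last exact: vdot_unit.
  by rewrite /vunit/= mulf_neq0// invr_neq0// gt_eqF.
rewrite /xi_integral; have [_ _ _ ->] := cc.
- by apply: eq_integral => q _; rewrite -!muleA [X in _ * X]muleC.
- exact: measurable_xi_integrand.
- by move=> x; rewrite mule_ge0// lee_fin ball_ind_ge0.
Qed.

End xi.

(** * Collision maps *)

Section collision_algebra.
Context {R : realType}.
Implicit Types (v w u n k : vec R) (e c : R) (p : vec R * vec R).

Lemma vscale_unit u : 0 < vnorm u -> vscale (vnorm u) (vunit u) = u.
Proof.
move=> u0; rewrite /vunit; case: u u0 => -[u1 u2] u3 u0; rewrite /vscale/=.
by congr (_, _, _); rewrite mulVKf// gt_eqF.
Qed.

Lemma mirrorZ n (a : R) k : mirror n (vscale a k) = vscale a (mirror n k).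
Proof.
by rewrite /mirror vdotZl /vsub /vadd /vscale/=; congr (_, _, _); ring.
Qed.

Lemma vdot_mirror n k : vdot k k = 1 -> vdot k (mirror n k) = 1 - 2 * vdot k n ^+ 2.
Proof.
move=> k1; transitivity (vdot k k - 2 * vdot k n ^+ 2); last by rewrite k1.
by rewrite /mirror /vdot/=; ring.
Qed.

Lemma sqr_vdot_le1 n k : vdot n n = 1 -> vdot k k = 1 -> vdot k n ^+ 2 <= 1.
Proof.
move=> n1 k1; rewrite -subr_ge0.
have -> : 1 - vdot k n ^+ 2 =
    vdot (vsub k (vscale (vdot k n) n)) (vsub k (vscale (vdot k n) n)).
  transitivity (vdot k k - 2 * vdot k n ^+ 2 + vdot k n ^+ 2 * vdot n n).
    by rewrite n1 k1; ring.
  by rewrite /vdot /vsub /vadd /vscale/=; ring.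
exact: vdot_ge0.
Qed.

Lemma collide_sub c n p :
  vsub (collide c n p).1 (collide c n p).2 =
  vsub (vsub p.1 p.2) (vscale (2 * c * vdot (vsub p.1 p.2) n) n).
Proof.
rewrite /collide/=; set t := vdot _ n.
by rewrite /vsub /vadd /vscale/=; congr (_, _, _); ring.
Qed.

Lemma vdot_collide c n p : vdot n n = 1 ->
  vdot (vsub (collide c n p).1 (collide c n p).2) n =
  (1 - 2 * c) * vdot (vsub p.1 p.2) n.
Proof.
move=> n1; rewrite collide_sub; set u := vsub _ p.2.
transitivity (vdot u n - 2 * c * vdot u n * vdot n n); last by rewrite n1; ring.
by rewrite /vdot /vsub /vadd /vscale/=; ring.
Qed.

(** For c = (1 + e)/2 the coefficient 4c (1 - c) is 1 - e^2, the usual loss of kinetic energy. *)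
Lemma sqr_vnorm_collide c n p : vdot n n = 1 ->
  vnorm (vsub (collide c n p).1 (collide c n p).2) ^+ 2 =
  vnorm (vsub p.1 p.2) ^+ 2 - 4 * c * (1 - c) * vdot (vsub p.1 p.2) n ^+ 2.
Proof.
move=> n1; rewrite !sqr_vnorm collide_sub; set u := vsub _ p.2.
transitivity (vdot u u - 4 * c * vdot u n ^+ 2
  + 4 * c ^+ 2 * vdot u n ^+ 2 * vdot n n); last by rewrite n1; ring.
by rewrite /vsub /vadd /vscale/= /vdot/=; ring.
Qed.

(** The inner map multiplies u . n by -1/e, and the two displacements cancel: (1 + 1/e)/2 - (1 +
    e)/(2e) = 0. *)
Lemma collideK e n p : e != 0 -> vdot n n = 1 ->
  collide ((1 + e) / 2) n (collide ((1 + e^-1) / 2) n p) = p.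
Proof.
move=> e0 n1; rewrite {1}/collide vdot_collide//; case: p => v w.
rewrite /collide/=; set t := vdot _ n; case: v t => -[v1 v2] v3 t.
case: w t => -[w1 w2] w3 t; rewrite /vsub /vadd /vscale/=.
by congr ((_, _, _), (_, _, _)); field.
Qed.

(** Since |u| S_n k = S_n u, the velocity part is u/2 - (1 + e)/2 (u . n) n. For the direction, k .
    S_n k = 1 - 2 (k . n)^2 makes the radicand 4 |u'|^2 / |u|^2, while the numerator is 2 (k - (1 -
    e)(k . n) n) = 2 S_n u' / |u|. *)
Lemma Cs_mirror e v w n : 0 < vnorm (vsub v w) -> vdot n n = 1 ->
  let q := collide ((1 + e) / 2) n (v, w) in
  0 < vnorm (vsub q.1 q.2) ->
  Cs e v w (mirror n (vunit (vsub v w))) =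
  (q, mirror n (vunit (vsub q.1 q.2))).
Proof.
move=> u0 n1 q q0; have un0 := lt0r_neq0 u0; have qn0 := lt0r_neq0 q0.
rewrite /Cs; congr (_, _).
  have E : vadd (vscale ((1 - e) / 4) (vsub v w))
      (vscale ((1 + e) / 4 * vnorm (vsub v w)) (mirror n (vunit (vsub v w)))) =
    vsub (vscale (1 / 2) (vsub v w))
      (vscale ((1 + e) / 2 * vdot (vsub v w) n) n).
    rewrite (_ : vscale (_ * _) _ =
        vscale ((1 + e) / 4) (mirror n (vsub v w))); last first.
      rewrite -[in RHS](vscale_unit u0) mirrorZ /vscale/=.
      by congr (_, _, _); ring.
    rewrite /mirror; set u := vsub v w; set t := vdot u n.
    by rewrite /vsub /vadd /vscale/=; congr (_, _, _); field.
  rewrite E /q /collide/=; set t := _ * vdot _ n.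
  case: v t {u0 un0 E q q0 qn0} => -[v1 v2] v3 t; case: w t => -[w1 w2] w3 t.
  by rewrite /vsub /vadd /vscale/=; congr ((_, _, _), (_, _, _)); field.
have k1 := vdot_unit u0; set u := vsub v w in u0 un0 k1 *.
have tE : vdot (vunit u) n = vdot u n / vnorm u by rewrite vdotZl mulrC.
have qE := sqr_vnorm_collide ((1 + e) / 2) (v, w) n1.
rewrite -/q -/u /= -/u in qE.
rewrite vdot_mirror//.
rewrite (_ : 2 * _ + _ = (2 * vnorm (vsub q.1 q.2) / vnorm u) ^+ 2); last first.
  by rewrite tE !exprMn qE exprVn; field.
rewrite sqrtr_sqr ger0_norm; last by rewrite divr_ge0// ?mulr_ge0// ltW.
rewrite [in RHS]/vunit mirrorZ.
have -> : mirror n (vsub q.1 q.2) = vsub u (vscale ((1 - e) * vdot u n) n).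
  rewrite /mirror vdot_collide// collide_sub /= -/u; set t := vdot u n.
  by rewrite /vsub /vadd /vscale/=; congr (_, _, _); field.
rewrite /mirror tE /vunit; set t := vdot u n.
set r := vnorm u in un0 *; set r' := vnorm _ in qn0 *.
rewrite /vsub /vadd /vscale/=.
by congr (_, _, _); field; rewrite un0 qn0.
Qed.

(** Replacing e by 1/e produces a factor 1/e both in the numerator of the direction and in the
    square root below it. *)
Lemma Cs_invE e v w n : 0 < e -> Cs_inv e v w n = Cs e^-1 v w n.
Proof.
move=> e0; have en0 := lt0r_neq0 e0.
rewrite /Cs_inv /Cs; set u := vsub v w; set k := vunit u; congr (_, _).
  rewrite (_ : - ((1 - e) / (4 * e)) = (1 - e^-1) / 4); last by field.
  by rewrite (_ : (1 + e) / (4 * e) = (1 + e^-1) / 4); last by field.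
set D := 2 * (1 + e ^+ 2) - _.
rewrite (_ : 2 * (1 + e^-1 ^+ 2) + _ = e^-1 ^+ 2 * D); last first.
  by rewrite /D; field.
rewrite sqrtrM ?sqr_ge0// sqrtr_sqr ger0_norm ?invr_ge0 ?ltW// invfM invrK.
set d := (Num.sqrt D)^-1.
rewrite /vsub /vadd /vscale/=; set i := (vnorm u)^-1.
by congr (_, _, _); field.
Qed.

Lemma Cr_invE e v w n : 0 < e ->
  Cr_inv e v w n = (collide ((1 + e^-1) / 2) n (v, w), n).
Proof.
move=> /lt0r_neq0 e0; rewrite /Cr_inv /collide/=.
by rewrite (_ : (1 + e) / (2 * e) = (1 + e^-1) / 2); last by field.
Qed.

(** * Kernels at the precollisional velocities *)

Section precollision.
Variables (e : R) (v w n : vec R).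
Hypotheses (e01 : 0 < e <= 1) (u0 : 0 < vnorm (vsub v w)) (n1 : vdot n n = 1).
Let u := vsub v w.
Let k := vunit u.
Let q := collide ((1 + e^-1) / 2) n (v, w).
Let u' := vsub q.1 q.2.
(** The ratio |u'|^2 / |u|^2 equals [W] / e^2. For sigma = S_n k, moreover, 2 [W] = (1 + e^2) - (1 -
    e^2) k . sigma, the radicand in the modified kernels. *)
Let W := e ^+ 2 + (1 - e ^+ 2) * vdot k n ^+ 2.

Let e0 : 0 < e. Proof. by case/andP: e01. Qed.

Let en0 : e != 0. Proof. exact: lt0r_neq0. Qed.

Let W0 : 0 < W.
Proof.
rewrite ltr_pwDl ?exprn_gt0// mulr_ge0 ?sqr_ge0// subr_ge0 exprn_ile1//.
  exact: ltW.
by case/andP: e01.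
Qed.

Let sW0 : Num.sqrt W != 0. Proof. by rewrite gt_eqF// sqrtr_gt0. Qed.

Let un0 : vnorm u != 0. Proof. exact: lt0r_neq0. Qed.

Lemma vnorm_precollision : vnorm u' = vnorm u / e * Num.sqrt W.
Proof.
apply: (pexpIrn (isT : 0 < 2)%N); rewrite ?nnegrE ?sqrtr_ge0//.
  by rewrite mulr_ge0 ?sqrtr_ge0// divr_ge0 ?sqrtr_ge0// ltW.
rewrite exprMn (sqr_sqrtr (ltW W0)) /u' /q sqr_vnorm_collide//= -/u /W /k.
by rewrite /vunit vdotZl; field; rewrite un0 en0.
Qed.

Lemma vnorm_precollision_gt0 : 0 < vnorm u'.
Proof. by rewrite vnorm_precollision mulr_gt0 ?divr_gt0// sqrtr_gt0. Qed.

Lemma vdot_precollision : vdot (vunit u') n = - (vdot k n / Num.sqrt W).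
Proof.
rewrite vdotZl vnorm_precollision /u' /q vdot_collide//= -/u /k vdotZl.
by field; rewrite sW0 un0 en0.
Qed.

(** The factor sqrt 2 / sqrt (2 W) = 1 / sqrt W of [Bplus] is what turns the weight |k . n| into |k'
    . n|. The argument of [B] there is 1 - 2 (k . n)^2 / W = k' . S_n k'. *)
Lemma swap_kernelE (Phi B : R -> R) :
  Phiplus Phi e (vnorm u) (vdot k (mirror n k)) *
    Bplus B e (vdot k (mirror n k)) * (2 * `|vdot k n|) =
  e^-1 * (Phi (vnorm u') * B (vdot (vunit u') (mirror n (vunit u'))) *
    (2 * `|vdot (vunit u') n|)).
Proof.
have k1 : vdot k k = 1 by exact: vdot_unit.
have k1' : vdot (vunit u') (vunit u') = 1.
  by apply: vdot_unit; exact: vnorm_precollision_gt0.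
rewrite !vdot_mirror// vdot_precollision vnorm_precollision /Phiplus /Bplus.
have -> : 1 + e ^+ 2 - (1 - e ^+ 2) * (1 - 2 * vdot k n ^+ 2) = 2 * W.
  by rewrite /W; ring.
have s20 : Num.sqrt (2 : R) != 0 by rewrite gt_eqF// sqrtr_gt0.
rewrite sqrtrM// (_ : _ / (Num.sqrt 2 * e) * _ = vnorm u / e * Num.sqrt W);
  last by field; rewrite s20 en0.
rewrite (_ : _ / (2 * W) = 1 - 2 * (- (vdot k n / Num.sqrt W)) ^+ 2); last first.
  rewrite sqrrN exprMn exprVn sqr_sqrtr ?(ltW W0)//.
  have := lt0r_neq0 W0; rewrite /W => Wn0; field; exact: Wn0.
rewrite normrN normrM normrV ?unitfE// (ger0_norm (sqrtr_ge0 W)).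
by field; rewrite sW0 en0 s20.
Qed.

(** A collision reverses the sign of k . n, which evenness of [Bt] absorbs. *)
Lemma reflection_kernelE (Phi Bt : R -> R) :
  (forall t, -1 <= t <= 1 -> Bt (- t) = Bt t) ->
  Phitplus Phi e (vnorm u) (vdot k n) * Btplus Bt e (vdot k n) =
  e^-1 * (Phi (vnorm u') * Bt (vdot (vunit u') n)).
Proof.
move=> Bte; rewrite vdot_precollision vnorm_precollision /Phitplus /Btplus -/W.
rewrite Bte; first by ring.
(* Evenness is available on [-1, 1] only; the bound (k . n)^2 <= W amounts to e^2 (1 - (k . n)^2) >=
   0. *)
rewrite -ler_norml -(@ler_pXn2r _ 2) ?nnegrE// real_normK ?num_real//.
rewrite expr1n exprMn exprVn sqr_sqrtr ?(ltW W0)// ler_pdivrMr// mul1r /W.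
have k1 : vdot k k = 1 by exact: vdot_unit.
by have := sqr_vdot_le1 n1 k1; have := sqr_ge0 e; nra.
Qed.

End precollision.
End collision_algebra.

(** * Reduction of signed integrals to nonnegative ones *)

Section Xi_integral.
Context {R : realType}.
Local Notation M := (measurableTypeR R).
Local Notation V := (M * M * M)%type.
Implicit Types (g h : vec R -> vec R -> vec R -> R).

(* The factor 3 is the one of the cone measure; [if] makes the function
   measurable on the whole space although [g] is only controlled on
   [cone_dom]. *)
Definition positive_part g (q : (V * V) * V) : \bar R :=
  if 0 < vnorm q.2 then (3 * Num.max (g q.1.1 q.1.2 (vunit q.2)) 0)%:E else 0%E.

Definition opp_integrand g v w s := - g v w s.

Lemma positive_part_ge0 g q : (0 <= positive_part g q)%E.
Proof.
rewrite /positive_part; case: ifP => // _.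
by rewrite lee_fin mulr_ge0// le_max lexx orbT.
Qed.

Lemma positive_part_unit g p n : vdot n n = 1 ->
  positive_part g (p, n) = (3 * Num.max (g p.1 p.2 n) 0)%:E.
Proof. by move=> n1; rewrite /positive_part/= vnorm1// ltr01 vunit1. Qed.

Lemma measurable_cone_dom : measurable (@cone_dom R : set ((V * V) * V)).
Proof.
have mb : measurable_fun [set: (V * V) * V]
    (fun q : (V * V) * V => 0 < vnorm q.2 <= 1) by measurable_vec.
rewrite (_ : @cone_dom R = [set: (V * V) * V] `&`
    (fun q : (V * V) * V => 0 < vnorm q.2 <= 1) @^-1` [set true]).
  exact: mb.
by rewrite setTI.
Qed.

(** The radial projection onto the unit sphere lands in [cone_dom], where measurability is known,
    and leaves the integrand unchanged because it depends on the direction only. *)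
Lemma measurable_positive_part g :
  measurable_fun (@cone_dom R : set ((V * V) * V)) (Xi_integrand g) ->
  measurable_fun [set: (V * V) * V] (positive_part g).
Proof.
move=> mg.
pose D := [set q : (V * V) * V | 0 < vnorm q.2].
have mb : measurable_fun [set: (V * V) * V]
    (fun q : (V * V) * V => 0 < vnorm q.2) by measurable_vec.
have mD : measurable D.
  rewrite (_ : D = [set: (V * V) * V] `&`
    (fun q : (V * V) * V => 0 < vnorm q.2) @^-1` [set true]); first exact: mb.
  by rewrite setTI.
have mU : measurable_fun [set: (V * V) * V]
    (fun q : (V * V) * V => (q.1, vunit q.2) : (V * V) * V) by measurable_vec.
have mgU : measurable_fun D (fun q : (V * V) * V =>
    maxe (Xi_integrand g (q.1, vunit q.2)) 0%E).
  apply: measurable_maxe; last exact: measurable_cst.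
  apply: (measurable_comp measurable_cone_dom _ mg (measurable_funTS mU)).
  move=> _ [q /= q0 <-]; rewrite /cone_dom/= vnorm1 ?vdot_unit//.
  by rewrite ltr01 lexx.
rewrite (_ : positive_part g = (fun q : (V * V) * V =>
    maxe (Xi_integrand g (q.1, vunit q.2)) 0%E) \_ D).
  by apply/(measurable_restrictT _ mD).
apply/funext => q; rewrite patchE /positive_part /D.
rewrite (_ : (q \in _) = (0 < vnorm q.2)); last by apply/idP/idP; rewrite inE.
case: ifP => // q0; rewrite /Xi_integrand/= (vunit1 (vdot_unit q0)).
by rewrite maxr_pMr// mulr0 EFin_max.
Qed.

Lemma integral_positive_part g :
  (\int[@lam9 R]_(p in @cone_dom R) maxe (Xi_integrand g p) 0 =
   xi_integral (positive_part g))%E.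
Proof.
rewrite [LHS]integral_mkcond; apply: eq_integral => q _.
rewrite patchE /ball_ind (_ : (q \in _) = (0 < vnorm q.2 <= 1)); last first.
  by apply/idP/idP; rewrite inE.
case: ifP => [/andP[q0 _]|_]; last by rewrite mule0.
rewrite mule1 positive_part_unit ?vdot_unit//= /Xi_integrand.
by rewrite maxr_pMr// mulr0 EFin_max.
Qed.

Lemma Xi_integralE g :
  Xi_integral g = (xi_integral (positive_part g) -
    xi_integral (positive_part (opp_integrand g)))%E.
Proof.
(* [leb9] and [lam9] are convertible; the latter only carries the sigma-finite structure. *)
have -> : Xi_integral g =
  (\int[@lam9 R]_(p in @cone_dom R) Xi_integrand g p)%E by [].
rewrite integralE -!integral_positive_part.
congr (_ - _)%E; apply: eq_integral => q _; first by rewrite funeposE.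
by rewrite funenegE /Xi_integrand /opp_integrand mulrN.
Qed.

Lemma measurable_opp_integrand g :
  measurable_fun (@cone_dom R : set ((V * V) * V)) (Xi_integrand g) ->
  measurable_fun (@cone_dom R : set ((V * V) * V)) (Xi_integrand (opp_integrand g)).
Proof.
move=> mg; rewrite (_ : Xi_integrand _ = (fun q => - Xi_integrand g q)%E).
  exact: measurableT_comp.
by apply/funext => q; rewrite /Xi_integrand /opp_integrand mulrN.
Qed.

End Xi_integral.

(** * From pointwise identities to integrals, and the theorem *)

Section transfer.
Context {R : realType} (e : R).
Hypothesis e01 : 0 < e <= 1.
Local Notation M := (measurableTypeR R).
Local Notation V := (M * M * M)%type.
Local Notation c := ((1 + e^-1) / 2).

Let e0 : 0 < e. Proof. by case/andP: e01. Qed.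

Let c0 : 1 - 2 * c != 0.
Proof.
rewrite (_ : 1 - _ = - e^-1); last by field; exact: lt0r_neq0.
by rewrite oppr_eq0 invr_eq0 lt0r_neq0.
Qed.

Let jacobianE : `|1 - 2 * c| = e^-1.
Proof.
rewrite (_ : 1 - _ = - e^-1); last by field; exact: lt0r_neq0.
by rewrite normrN ger0_norm// invr_ge0 ltW.
Qed.

Variables L Q : vec R -> vec R -> vec R -> R.
Hypothesis mL : measurable_fun (@cone_dom R : set ((V * V) * V)) (Xi_integrand L).
Hypothesis mQ : measurable_fun (@cone_dom R : set ((V * V) * V)) (Xi_integrand Q).

Let mPL := measurable_positive_part mL.
Let mPQ := measurable_positive_part mQ.

Lemma reflection_transfer :
  (forall v w n, 0 < vnorm (vsub v w) -> vdot n n = 1 ->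
    let q := collide c n (v, w) in L v w n = e^-1 * Q q.1 q.2 n) ->
  xi_integral (positive_part L) = xi_integral (positive_part Q).
Proof.
move=> LQ; rewrite [RHS](xi_integral_collide c0 mPQ (positive_part_ge0 Q)).
apply: ae_eq_xi_integral => //.
- exact: positive_part_ge0.
- apply: emeasurable_funM; last exact: measurable_cst.
  exact: (measurableT_comp mPQ (measurable_collide_fst c)).
- by move=> q; rewrite mule_ge0 ?positive_part_ge0.
move=> -[v w] /vnorm_gt0 u0; apply: eq_sphere_integral => n n1.
rewrite positive_part_unit// LQ//= /collide_fst/= positive_part_unit// jacobianE.
rewrite -EFinM; congr EFin.
set a := Q _ _ n.
have -> : Num.max (e^-1 * a) 0 = e^-1 * Num.max a 0.
  by rewrite maxr_pMr ?mulr0// invr_ge0 ltW.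
by ring.
Qed.

(** Once both integrals are taken over n, the velocities can change with the normal fixed, although
    sigma itself moves from S_n k to S_n k'. *)
Lemma swap_transfer :
  (forall v w n, 0 < vnorm (vsub v w) -> vdot n n = 1 ->
    let k := vunit (vsub v w) in
    let q := collide c n (v, w) in let k' := vunit (vsub q.1 q.2) in
    L v w (mirror n k) * (2 * `|vdot k n|) =
    e^-1 * (Q q.1 q.2 (mirror n k') * (2 * `|vdot k' n|))) ->
  xi_integral (positive_part L) = xi_integral (positive_part Q).
Proof.
move=> LQ; rewrite (xi_integral_mirror mPL (positive_part_ge0 L)).
rewrite (xi_integral_mirror mPQ (positive_part_ge0 Q)).
have mwe0 g q : (0 <= positive_part g (mirror_direction q) *
    (mirror_weight q)%:E :> \bar R)%E.
  by rewrite mule_ge0 ?positive_part_ge0// lee_fin mulr_ge0.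
rewrite [RHS](xi_integral_collide c0 (measurable_mirror_direction mPQ)
  (mwe0 Q)).
apply: ae_eq_xi_integral.
- exact: measurable_mirror_direction.
- exact: mwe0.
- apply: emeasurable_funM; last exact: measurable_cst.
  exact: (measurableT_comp (measurable_mirror_direction mPQ)
    (measurable_collide_fst c)).
- by move=> q; rewrite mule_ge0.
move=> -[v w] /vnorm_gt0 u0; apply: eq_sphere_integral => n n1.
have q0 := vnorm_precollision_gt0 e01 u0 n1.
have mirror1 k : vdot k k = 1 -> vdot (mirror n k) (mirror n k) = 1.
  move=> k1; rewrite -[RHS]k1.
  transitivity (vdot k k - 4 * vdot k n ^+ 2 + 4 * vdot k n ^+ 2 * vdot n n).
    by rewrite /mirror /vdot /vsub /vadd /vscale/=; ring.
  by rewrite n1; ring.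
rewrite /mirror_direction /mirror_weight /collide_fst/=.
rewrite !positive_part_unit; [|by apply: mirror1; exact: vdot_unit..].
rewrite jacobianE -!EFinM; congr EFin => /=.
have := LQ v w n u0 n1; cbv zeta.
set a := 2 * `|vdot (vunit (vsub v w)) n|; set b := 2 * `|_| => LQE.
(* Nonnegative factors commute with the maximum with 0, so the signed identity passes to positive
   parts. *)
have [a0 b0] : 0 <= a /\ 0 <= b by rewrite !mulr_ge0.
set l := L v w _ in LQE *; set r := Q _ _ _ in LQE *.
have -> : 3 * Num.max l 0 * a = 3 * (e^-1 * (Num.max r 0 * b)).
  rewrite -[LHS]mulrA; congr (3 * _).
  by rewrite !maxr_pMl// !mul0r LQE maxr_pMr ?mulr0// invr_ge0 ltW.
by ring.
Qed.

End transfer.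

Unset Implicit Arguments.

Theorem theoremA1 (R : realType) (e : R) (Phi B Bt : R -> R)
  (K : Xi R -> Xi R -> R) :
  0 < e <= 1 ->
  (forall r, 0 <= r -> 0 <= Phi r) ->
  (forall t, -1 <= t <= 1 -> Bt (- t) = Bt t) ->
  (forall t, -1 <= t <= 1 -> 0 <= Bt t) ->
  (forall s, -1 <= s < 1 ->
     B s = Bt (Num.sqrt ((1 - s) / 2)) / (2 * Num.sqrt ((1 - s) / 2))) ->
  {within [set pq : Xi R * Xi R | inXi pq.1 /\ inXi pq.2],
     continuous (fun pq : Xi R * Xi R => K pq.1 pq.2)} ->
  let LHSs := fun v w s : vec R =>
    let u := vsub v w in let k := vunit u in
    K (Cs_inv e v w s) ((v, w), s)
      * Phiplus Phi e (vnorm u) (vdot k s) * Bplus B e (vdot k s) in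
  let RHSs := fun v w s : vec R =>
    let u := vsub v w in let k := vunit u in
    K ((v, w), s) (Cs e v w s) * Phi (vnorm u) * B (vdot k s) in
  let LHSr := fun v w n : vec R =>
    let u := vsub v w in let k := vunit u in
    K (Cr_inv e v w n) ((v, w), n)
      * Phitplus Phi e (vnorm u) (vdot k n) * Btplus Bt e (vdot k n) in
  let RHSr := fun v w n : vec R =>
    let u := vsub v w in let k := vunit u in
    K ((v, w), n) (Cr e v w n) * Phi (vnorm u) * Bt (vdot k n) in
  Xi_integrable LHSs -> Xi_integrable RHSs ->
  Xi_integrable LHSr -> Xi_integrable RHSr ->
  ((4 * pi)^-1%:E * Xi_integral LHSs = (4 * pi)^-1%:E * Xi_integral RHSs)%E /\
  ((4 * pi)^-1%:E * Xi_integral LHSr = (4 * pi)^-1%:E * Xi_integral RHSr)%E.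
Proof.
move=> e01 _ Bt_even _ _ _ LHSs RHSs LHSr RHSr.
move=> /measurable_int mLs /measurable_int mRs /measurable_int mLr
  /measurable_int mRr.
have e0 : 0 < e by case/andP: e01.
(* With q the precollisional velocities, [Cs_inv] sends (v, w, S_n k) to (q, S_n k') and [Cs] sends
   it back: [K] is evaluated at the same pair of points on both sides, and only the kernels have to
   be compared. *)
have swapE v w n : 0 < vnorm (vsub v w) -> vdot n n = 1 ->
    let k := vunit (vsub v w) in
    let q := collide ((1 + e^-1) / 2) n (v, w) in
    let k' := vunit (vsub q.1 q.2) in
    LHSs v w (mirror n k) * (2 * `|vdot k n|) =
    e^-1 * (RHSs q.1 q.2 (mirror n k') * (2 * `|vdot k' n|)).
  move=> u0 n1 k q k'; rewrite /LHSs /RHSs -/k -/k'.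
  have q0 := vnorm_precollision_gt0 e01 u0 n1.
  have qK : collide ((1 + e) / 2) n (q.1, q.2) = (v, w).
    by rewrite -surjective_pairing collideK// lt0r_neq0.
  have -> : Cs_inv e v w (mirror n k) = (q.1, q.2, mirror n k').
    by rewrite Cs_invE// Cs_mirror// -surjective_pairing.
  have -> : Cs e q.1 q.2 (mirror n k') = (v, w, mirror n k).
    by rewrite Cs_mirror// qK.
  have kE := swap_kernelE e01 u0 n1 Phi B.
  rewrite -/k -/q -/k' in kE.
  by rewrite -[X in X * _]mulrA -mulrA kE; ring.
have reflE v w n : 0 < vnorm (vsub v w) -> vdot n n = 1 ->
    let q := collide ((1 + e^-1) / 2) n (v, w) in
    LHSr v w n = e^-1 * RHSr q.1 q.2 n.
  move=> u0 n1 q; rewrite /LHSr /RHSr.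
  have qK : collide ((1 + e) / 2) n (q.1, q.2) = (v, w).
    by rewrite -surjective_pairing collideK// lt0r_neq0.
  have -> : Cr e q.1 q.2 n = (v, w, n) by rewrite -qK.
  rewrite Cr_invE// -/q -[LHS]mulrA (reflection_kernelE e01 u0 n1 Phi Bt_even).
  by rewrite -/q -surjective_pairing; ring.
split; congr (_ * _)%E; rewrite !Xi_integralE; congr (_ - _)%E.
- exact: (swap_transfer e01 mLs mRs swapE).
(* The negative parts are the positive parts of the opposite integrands, which satisfy the same
   pointwise identity. *)
- apply: (swap_transfer e01 (measurable_opp_integrand mLs)
    (measurable_opp_integrand mRs)).
  move=> v w n u0 n1; rewrite /= /opp_integrand !mulNr mulrN; congr (- _).
  exact: swapE.
- exact: (reflection_transfer e01 mLr mRr reflE).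
- apply: (reflection_transfer e01 (measurable_opp_integrand mLr)
    (measurable_opp_integrand mRr)).
  move=> v w n u0 n1; rewrite /= /opp_integrand mulrN; congr (- _).
  exact: reflE.
Qed.
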